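(* Let $\nu$ be any norm on $\mathbb{R}^2$. Then the set $\mathbf{DI}_\nu=\{\mathbf{x}\in\mathbb{R}^2 : c_\nu(\mathbf{x})<c_\nu\}$ contains the set $\mathbf{BA}$ of badly approximable pairs; hence $\mathbf{DI}_\nu$ is hyperplane absolute winning.
   Context: For a norm $\nu$ on $\mathbb{R}^2$, let $\operatorname{dist}_\nu$ be the distance function induced by $\nu$, so $\operatorname{dist}_\nu(\mathbf{y},\mathbb{Z}^2)=\min_{\mathbf{p}\in\mathbb{Z}^2}\nu(\mathbf{y}-\mathbf{p})$. For $\mathbf{x}\in\mathbb{R}^2$ define $$c_\nu(\mathbf{x})=\limsup_{t\to\infty}\ t\cdot\Big(\min_{1\le q\le t}\operatorname{dist}_\nu(q\mathbf{x},\mathbb{Z}^2)\Big)^2,\qquad c_\nu=\sup_{\mathbf{x}\in\mathbb{R}^2}c_\nu(\mathbf{x}),$$ where $q$ ranges over integers and $t$ over real numbers. Badly approximable pairs: $$\mathbf{BA}=\Big\{\mathbf{x}\in\mathbb{R}^2:\ \liminf_{t\to\infty}\ t\Big(\min_{1\le q\le t}\operatorname{dist}(q\mathbf{x},\mathbb{Z}^2)\Big)^2>0\Big\},$$ where $q$ ranges over integers and $\operatorname{dist}$ is the distance with respect to any fixed norm on $\mathbb{R}^2$ (the set does not depend on the choice). Hyperplane absolute winning (for subsets of $\mathbb{R}^d$; here $d=2$, so hyperplanes are affine lines): for $0<\beta<1/3$, the $\beta$-hyperplane absolute game is played by Bob and Alice. Bob first chooses a closed ball $B_1\subset\mathbb{R}^d$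 of radius $\rho_1>0$. At stage $i\ge1$, after Bob has chosen a closed ball $B_i$ of radius $\rho_i$, Alice chooses an affine hyperplane $L_i$ and a number $0<\varepsilon_i\le\beta\rho_i$, and lets $A_i$ be the $\varepsilon_i$-neighborhood of $L_i$; then Bob chooses a closed ball $B_{i+1}\subset B_i\setminus A_i$ of radius $\rho_{i+1}\ge\beta\rho_i$. A set $S\subset\mathbb{R}^d$ is $\beta$-hyperplane absolute winning if Alice has a strategy guaranteeing $S\cap\bigcap_i B_i\neq\varnothing$, and it is hyperplane absolute winning if this holds for every $0<\beta<1/3$. *)

(* Defs.v *)
From mathcomp Require Import all_boot all_order all_algebra.
From mathcomp Require Import all_classical all_reals all_analysis.

Set Implicit Arguments.
Unset Strict Implicit.
Unset Printing Implicit Defensive.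

Import Order.TTheory GRing.Theory Num.Theory.
Import numFieldNormedType.Exports.

Local Open Scope classical_set_scope.
Local Open Scope ring_scope.

Section Norms.
Context {R : realType}.

Record is_norm (d : nat) (nu : 'rV[R]_d -> R) : Prop := IsNorm {
  is_norm_triangle : forall x y, nu (x + y) <= nu x + nu y;
  is_norm_homog : forall (a : R) x, nu (a *: x) = `|a| * nu x;
  is_norm_eq0 : forall x, nu x = 0 -> x = 0
}.

(* The norm that MathComp-Analysis puts on 'rV[R]_d is the sup norm. *)
Definition enorm {d : nat} (x : 'rV[R]_d) : R :=
  Num.sqrt (\sum_(i < d) x 0 i ^+ 2).

End Norms.

Section Approximation.
Context {R : realType}.
Implicit Types (nu : 'rV[R]_2 -> R) (x y : 'rV[R]_2).

(* For a norm nu the infimum is attained. *)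
Definition distZ2 nu y : R :=
  inf [set nu (y - map_mx intr p) | p in [set: 'rV[int]_2]].

(* For t >= 1 this is a minimum over a nonempty finite set; for t < 1 the set
   is empty and the value is 0, which does not affect the limits at +oo. *)
Definition min_distZ2 nu x (t : R) : R :=
  inf [set distZ2 nu (q%:R *: x) | q in [set q : nat | (1 <= q)%N /\ q%:R <= t]].

(* The limsup, liminf and sup are taken in the extended reals. *)
Definition approx_limsup nu x : \bar R :=
  limf_esup (fun t : R => (t * min_distZ2 nu x t ^+ 2)%:E) (pinfty_nbhs R).

Definition approx_sup nu : \bar R := ereal_sup (range (approx_limsup nu)).

Definition DI nu : set 'rV[R]_2 :=
  [set x | (approx_limsup nu x < approx_sup nu)%E].

Definition BA nu : set 'rV[R]_2 :=
  [set x | (0 < limf_einf (fun t : R => (t * min_distZ2 nu x t ^+ 2)%:E)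
                          (pinfty_nbhs R))%E].

End Approximation.

Section HyperplaneAbsoluteGame.
Context {R : realType} {d : nat}.
Implicit Types (beta : R) (S L : set 'rV[R]_d).

Definition is_hyperplane L : Prop :=
  exists (a : 'rV[R]_d) (b : R),
    a != 0 /\ L = [set x | \sum_(i < d) a 0 i * x 0 i = b].

Definition neighborhood L (eps : R) : set 'rV[R]_d :=
  [set x | exists2 y, L y & enorm (x - y) < eps].

(* A move of Bob is the pair (center, radius) of a closed Euclidean ball. *)
Definition bob_move : Type := ('rV[R]_d * R)%type.

Definition cball (b : bob_move) : set 'rV[R]_d := closed_ball_ enorm b.1 b.2.

(* A move of Alice is a pair (hyperplane, epsilon). *)
Definition alice_move : Type := (set 'rV[R]_d * R)%type.

(* A strategy of Alice answers the list of all of Bob's moves so far, the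
   latest move coming last. *)
Definition strategy : Type := seq bob_move -> alice_move.

(* Alice's answers must obey the rules on every history, so that she cannot
   win by leaving Bob without a legal move. *)
Definition legal_strategy beta (sigma : strategy) : Prop :=
  forall (h : seq bob_move) (b : bob_move), 0 < b.2 ->
    let A := sigma (rcons h b) in
    is_hyperplane A.1 /\ 0 < A.2 <= beta * b.2.

(* B i is Bob's ball B_(i+1) in the usual numbering from 1. *)
Definition legal_play beta (sigma : strategy) (B : nat -> bob_move) : Prop :=
  0 < (B 0%N).2 /\
  forall i : nat,
    let A := sigma (mkseq B i.+1) in
    cball (B i.+1) `<=` cball (B i) `\` neighborhood A.1 A.2 /\
    beta * (B i).2 <= (B i.+1).2.

Definition beta_hyperplane_absolute_winning beta S : Prop :=
  exists2 sigma : strategy, legal_strategy beta sigma &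
    forall B : nat -> bob_move, legal_play beta sigma B ->
      (S `&` \bigcap_i cball (B i)) !=set0.

Definition hyperplane_absolute_winning S : Prop :=
  forall beta : R, 0 < beta < 3^-1 -> beta_hyperplane_absolute_winning beta S.

End HyperplaneAbsoluteGame.

(* Main.v *)
Require Import Defs.
From HB Require Import structures.
From mathcomp Require Import all_boot all_order all_algebra.
From mathcomp Require Import all_classical all_reals all_analysis.
From mathcomp Require Import lra ring.

(** Why the theorem holds.

    Write r(T) for the minimal distance at time T and view the pair (x, T) as
    the lattice of all (y, z) = ((p + q x) / r(T), q / T), with p in Z^2 and q
    in Z. For large T it has no nonzero point in the open cylinder nu(y) < 1,
    |z| < 1, and its covolume is 1 / (T r(T)^2). So c_nu(x) is large exactly when cylinder-
    free lattices of small covolume occur at arbitrarily large times.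

    Two facts give the inclusion of BA in DI.

    - Any cylinder-free lattice is realised by some point: if its covolume is
      V, then for each c < 1/V there is x' with c_nu(x') >= c
      (approx_limsup_ge_of_admissible). It suffices that the points which are
      well spaced at some time beyond T0 are dense, since they form an open
      set and Baire's theorem then supplies a point that is well spaced at
      arbitrarily large times (well_spaced_dense). For density, a given lattice
      with basis matrix B has another basis M B, with M in GL_3(Z), which is
      up to a large scalar s close to the rows (1, 0, 0), (0, 1, 0),
      (th, 0), where th is any prescribed point of the plane. A small linear
      change of coordinates then turns s^-1 M B into the lattice of a point x
      near th. That M exists because integer matrices of rank at most two are,
      up to scaling and bounded error, unimodular: by the Smith normal form
      this is a statement about diag(1, d, 0)
      (unimodular_near_singular_multiple).

    - For a badly approximable x the covolume can be lowered by a factor that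
      does not depend on T (improved_lattice). Only points of the lattice with
      nu(y) < 1 and |z| near 1 obstruct the compression z -> (1 - eps) z. Two
      such points would differ by a lattice point whose existence contradicts
      bad approximability, so up to sign there is at most one, (w, z0); and w is
      bounded away from 0, again by bad approximability. Hence there is a
      bounded linear form l with l(w) = eps, and (y, z) -> (y, (1 - eps) z + l(y))
      keeps the lattice cylinder-free.

    Choosing T with T r(T)^2 close to c_nu(x), which is finite by Dirichlet's
    theorem, the compressed lattice has covolume less than 1 / c_nu(x) and so
    is realised by a point x' with c_nu(x') > c_nu(x).

    For the game, rational points of denominator at most a constant times
    rho^(-2/3) in a ball of radius comparable to rho lie on one line
    (rational_points_on_line): three of them off a line would span a triangle
    too small for its denominators. Alice removes that line every other turn;
    in the remaining turns she removes a line through the centre, which forces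
    the radii to tend to 0. The resulting point is badly approximable, and BA
    does not depend on the norm. *)

Set Implicit Arguments.
Unset Strict Implicit.
Unset Printing Implicit Defensive.

Import Order.TTheory GRing.Theory Num.Theory.
Import numFieldNormedType.Exports.

Local Open Scope classical_set_scope.
Local Open Scope ring_scope.

Local Notation "p %:V" := (map_mx intr p) (at level 2, format "p %:V").

(** * Norms on the plane *)
Lemma I2P (i : 'I_2) : i = 0 \/ i = 1.
Proof. by case: i => [[|[|//]] h]; [left|right]; apply/val_inj. Qed.

Lemma sum2 (A : nmodType) (F : 'I_2 -> A) : \sum_i F i = F 0 + F 1.
Proof.
by rewrite !big_ord_recl big_ord0 addr0; congr (F _ + F _); apply/val_inj.
Qed.

Section Plane.
Context {R : realType}.
Implicit Types (v w x : 'rV[R]_2) (e : R).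

Lemma row2P v w : v 0 0 = w 0 0 -> v 0 1 = w 0 1 -> v = w.
Proof. by move=> h0 h1; apply/rowP => i; case: (I2P i) => ->. Qed.

Lemma mx_norm_coord m n (A : 'M[R]_(m, n)) i j : `|A i j| <= `|A|.
Proof.
rewrite [leRHS]/Num.norm /= mx_normrE.
by apply/bigmax_geP; right => /=; exists (i, j).
Qed.

Lemma sup_norm_le v e : `|v 0 0| <= e -> `|v 0 1| <= e -> `|v| <= e.
Proof.
move=> h0 h1; rewrite [leLHS]/Num.norm /= mx_normrE; apply: bigmax_le => /=.
  exact: le_trans h0.
by case=> i j _ /=; rewrite (ord1 i); case: (I2P j) => ->.
Qed.

Lemma int_vec_norm_ge1 (p : 'rV[int]_2) : p != 0 -> 1 <= `|p%:V : 'rV[R]_2|.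
Proof.
move=> p0; have [i pi] : exists i, p 0 i != 0.
  apply/existsP; apply: contraNT p0; rewrite negb_exists => /forallP h.
  by apply/eqP/rowP => i; rewrite mxE; apply/eqP; rewrite -[_ == _]negbK h.
apply: le_trans (mx_norm_coord _ 0 i); rewrite mxE.
by rewrite -intr_norm ler1z -gtz0_ge1 normr_gt0.
Qed.

End Plane.

Section PlanarNorm.
Context {R : realType} (nu : 'rV[R]_2 -> R) (hnu : is_norm nu).
Implicit Types (v w x y : 'rV[R]_2).

Lemma norm_fun0 : nu 0 = 0.
Proof. by rewrite -(scale0r (0 : 'rV_2)) (is_norm_homog hnu) normr0 mul0r. Qed.

Lemma norm_funN x : nu (- x) = nu x.
Proof. by rewrite -scaleN1r (is_norm_homog hnu) normrN1 mul1r. Qed.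

Lemma norm_funB x y : nu (x - y) <= nu x + nu y.
Proof. by rewrite -(norm_funN y); exact: is_norm_triangle. Qed.

Lemma norm_fun_ge0 x : 0 <= nu x.
Proof.
have := norm_funB x x; rewrite subrr norm_fun0; lra.
Qed.

Lemma norm_fun_distl x y : nu x - nu y <= nu (x - y).
Proof. by have := is_norm_triangle hnu (x - y) y; rewrite subrK; lra. Qed.

Lemma norm_fun_scale_pos (a : R) x : 0 <= a -> nu (a *: x) = a * nu x.
Proof. by move=> a0; rewrite (is_norm_homog hnu) ger0_norm. Qed.

Lemma norm_fun_le_sup : exists2 C : R, 0 < C & forall x, nu x <= C * `|x|.
Proof.
pose e (i : 'I_2) : 'rV[R]_2 := delta_mx 0 i.
exists (nu (e 0) + nu (e 1) + 1) => [|x].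
  by have := norm_fun_ge0 (e 0); have := norm_fun_ge0 (e 1); lra.
have -> : x = x 0 0 *: e 0 + x 0 1 *: e 1.
  by apply: row2P; rewrite !mxE /= ?mulr1 ?mulr0 ?addr0 ?add0r.
set y := _ + _; have yx : y = x.
  by apply: row2P; rewrite !mxE /= ?mulr1 ?mulr0 ?addr0 ?add0r.
apply: le_trans (is_norm_triangle hnu _ _) _.
rewrite !(is_norm_homog hnu) yx.
have := mx_norm_coord x 0 0; have := mx_norm_coord x 0 1.
have := norm_fun_ge0 (e 0); have := norm_fun_ge0 (e 1).
have := normr_ge0 x; nra.
Qed.

Lemma norm_fun_continuous : continuous nu.
Proof.
have [C C0 hC] := norm_fun_le_sup.
move=> x; apply/(@cvgrPdist_le _ _ _ (nbhs x) _ nu (nu x)) => /= e e0.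
apply/nbhs_ballP; exists (e / C); first exact: divr_gt0.
move=> y; rewrite mx_norm_ball /ball_ /= => /ltW hxy.
have : C * `|x - y| <= e by rewrite mulrC -ler_pdivlMr.
have := hC (x - y); have := hC (y - x); rewrite (distrC y x).
have := norm_fun_distl x y; have := norm_fun_distl y x.
move=> h1 h2 h3 h4 h5; rewrite ler_norml; apply/andP; split; lra.
Qed.

(** Compactness of the unit sphere of the sup norm; with [norm_fun_le_sup] it
    makes all norms on the plane equivalent. *)
Lemma norm_fun_ge_sup : exists2 c : R, 0 < c & forall x, c * `|x| <= nu x.
Proof.
pose S := [set x : 'rV[R]_2 | `|x| = 1].
have S0 : S !=set0.
  exists (const_mx 1); rewrite /S /=; apply/eqP; rewrite eq_le.
  apply/andP; split; first by apply: sup_norm_le; rewrite mxE normr1.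
  by have := mx_norm_coord (const_mx 1 : 'rV[R]_2) 0 0; rewrite mxE normr1.
have cS : compact S.
  apply: bounded_closed_compact.
    exists 1; split; first exact: num_real.
    by move=> M M1 x /= ->; exact: ltW.
  rewrite (_ : S = (fun x : 'rV[R]_2 => `|x|) @^-1` [set 1]); last by [].
  apply: preimage_closed; last exact: closed_eq.
  by move=> x _; exact: norm_continuous.
have cf : {within S, continuous nu}.
  by apply: continuous_subspaceT; exact: norm_fun_continuous.
have [m mS mmin] := EVT_min_rV S0 cS cf.
rewrite inE /S /= in mS.
exists (nu m).
  rewrite lt_def norm_fun_ge0 andbT; apply/eqP => /(is_norm_eq0 hnu) m0.
  by move: mS; rewrite m0 normr0 => /eqP; rewrite eq_sym oner_eq0.
move=> x; have [->|x0] := eqVneq x 0; first by rewrite normr0 mulr0 norm_fun0.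
have nx : 0 < `|x| by rewrite normr_gt0.
rewrite -ler_pdivlMr // mulrC -[`|x|^-1]ger0_norm ?invr_ge0 //.
rewrite -(is_norm_homog hnu); apply: mmin.
by rewrite inE /S /= normrZ ger0_norm ?invr_ge0 // mulVf // gt_eqF.
Qed.

End PlanarNorm.

(** * Distances to the integer lattice and bad approximability *)
Section Distances.
Context {R : realType} (nu : 'rV[R]_2 -> R) (hnu : is_norm nu).
Implicit Types (x y : 'rV[R]_2) (t d : R).

Lemma distZ2_le y (p : 'rV[int]_2) : distZ2 nu y <= nu (y - p%:V).
Proof.
apply: ge_inf; last by exists p.
by exists 0 => _ [q _ <-]; exact: norm_fun_ge0.
Qed.

Lemma distZ2_ge y d : (forall p : 'rV[int]_2, d <= nu (y - p%:V)) ->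
  d <= distZ2 nu y.
Proof.
move=> h; apply: lb_le_inf; first by exists (nu (y - 0%:V)), 0.
by move=> _ [p _ <-].
Qed.

Lemma distZ2_ge0 y : 0 <= distZ2 nu y.
Proof. by apply: distZ2_ge => p; exact: norm_fun_ge0. Qed.

Lemma min_distZ2_le x t (q : nat) (p : 'rV[int]_2) :
  (1 <= q)%N -> q%:R <= t -> min_distZ2 nu x t <= nu (q%:R *: x - p%:V).
Proof.
move=> q1 qt; apply: le_trans (distZ2_le _ p).
apply: ge_inf; last by exists q.
by exists 0 => _ [k _ <-]; exact: distZ2_ge0.
Qed.

Lemma min_distZ2_ge x t d : 1 <= t ->
  (forall (q : nat) (p : 'rV[int]_2), (1 <= q)%N -> q%:R <= t ->
    d <= nu (q%:R *: x - p%:V)) ->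
  d <= min_distZ2 nu x t.
Proof.
move=> t1 h; apply: lb_le_inf; first by exists (distZ2 nu (1%:R *: x)), 1%N.
by move=> _ [q [q1 qt] <-]; apply: distZ2_ge => p; exact: h.
Qed.

Lemma min_distZ2_ge0 x t : 1 <= t -> 0 <= min_distZ2 nu x t.
Proof. by move=> t1; apply: min_distZ2_ge => // q p _ _; exact: norm_fun_ge0. Qed.

End Distances.

Section LimitsAtInfinity.
Context {R : realType}.
Implicit Types (f : R -> R) (c : R).

Lemma limsup_pinfty_ge f c : (forall A, exists2 t, A < t & c <= f t) ->
  (c%:E <= limf_esup (fun t => (f t)%:E) (pinfty_nbhs R))%E.
Proof.
move=> h; rewrite limf_esupE; apply: le_ereal_inf_tmp => _ [V [A [_ hA]] <-].
have [t At ct] := h A.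
apply: (@le_trans _ _ (f t)%:E); first by rewrite lee_fin.
by apply: ereal_sup_ubound; exists t => //; exact: hA.
Qed.

Lemma limsup_pinfty_le f c A : (forall t, A < t -> f t <= c) ->
  (limf_esup (fun t => (f t)%:E) (pinfty_nbhs R) <= c%:E)%E.
Proof.
move=> h; rewrite limf_esupE.
apply: (@le_trans _ _ (ereal_sup ((fun t => (f t)%:E) @` [set t | A < t]))).
  apply: ereal_inf_lbound; exists [set t | A < t] => //.
  by exists A; split => //; exact: num_real.
by apply: ge_ereal_sup => _ [t /= At <-]; rewrite lee_fin h.
Qed.

Lemma limsup_pinfty_gt f c :
  (c%:E < limf_esup (fun t => (f t)%:E) (pinfty_nbhs R))%E ->
  forall A, exists2 t, A < t & c < f t.
Proof.
move=> h A; apply: contrapT => h'; move: h; apply/negP; rewrite -leNgt.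
apply: (@limsup_pinfty_le f c A) => t At; rewrite leNgt; apply/negP => ct.
by apply: h'; exists t.
Qed.

Lemma liminf_pinfty_gt0 f :
  (0 < limf_einf (fun t => (f t)%:E) (pinfty_nbhs R))%E <->
  exists2 c, 0 < c & exists A, forall t, A < t -> c <= f t.
Proof.
rewrite limf_einfE; split.
  move=> /ereal_sup_gt[_ [V [A [_ hA]] <-] h].
  suff [c c0 hc] : exists2 c, 0 < c & (c%:E <= ereal_inf [set (f x)%:E | x in V])%E.
    exists c => //; exists A => t At.
    rewrite -lee_fin; apply: (le_trans hc); apply: ereal_inf_lbound.
    by exists t => //; exact: hA.
  case: (ereal_inf _) h => [r r0|_|//].
    by exists r.
  by exists 1 => //; exact: leey.
move=> [c c0 [A hA]].
apply: (@lt_le_trans _ _ c%:E); first by rewrite lte_fin.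
apply: (@le_trans _ _ (ereal_inf [set (f x)%:E | x in [set t | A < t]])).
  by apply: le_ereal_inf_tmp => _ [t /= At <-]; rewrite lee_fin hA.
apply: ereal_sup_ubound; exists [set t | A < t] => //.
by exists A; split => //; exact: num_real.
Qed.

End LimitsAtInfinity.

Section BadlyApproximable.
Context {R : realType} (nu : 'rV[R]_2 -> R) (hnu : is_norm nu).

Lemma BA_lower_bound x (c t : R) : 0 < c ->
  (forall (q : nat) (p : 'rV[int]_2), (1 <= q)%N ->
    c <= q%:R * nu (q%:R *: x - p%:V) ^+ 2) ->
  1 <= t -> c <= t * min_distZ2 nu x t ^+ 2.
Proof.
move=> c0 hc t1.
have t0 : 0 < t by lra.
rewrite -[c](@mulfVK _ t) ?gt_eqF // mulrC ler_wpM2l //; first exact: ltW.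
have ct : 0 <= c / t by apply: ltW; exact: divr_gt0.
rewrite -[c / t]sqr_sqrtr // lerXn2r ?nnegrE ?sqrtr_ge0 //.
  by apply: min_distZ2_ge0 => //; lra.
apply: min_distZ2_ge => [|q p q1 qt]; first lra.
rewrite -[leRHS]ger0_norm ?norm_fun_ge0 // -sqrtr_sqr ler_sqrt ?sqr_ge0 //.
rewrite ler_pdivrMr // mulrC; apply: le_trans (hc q p q1) _.
by rewrite ler_wpM2r ?sqr_ge0.
Qed.

(** From the liminf to a bound for every denominator: if the bound c holds at all
    times beyond t0, apply it at time q t0, where q is already among the
    denominators of the minimum; the price is a factor t0. *)
Lemma BA_uniformP x : BA nu x <->
  exists2 c : R, 0 < c & forall (q : nat) (p : 'rV[int]_2), (1 <= q)%N ->
    c <= q%:R * nu (q%:R *: x - p%:V) ^+ 2.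
Proof.
rewrite /BA /= liminf_pinfty_gt0; split=> [[c c0 [A hA]]|[c c0 hc]].
  pose t0 := Num.max (A + 1) 1.
  have t01 : 1 <= t0 by rewrite le_max lexx orbT.
  have At0 : A < t0 by rewrite lt_max ltrDl ltr01.
  exists (c / t0) => [|q p q1]; first by rewrite divr_gt0 //; lra.
  have q1R : 1 <= q%:R :> R by rewrite ler1n.
  have := hA (q%:R * t0); rewrite ler_pdivrMr; last by lra.
  have /[swap] /[apply] : A < q%:R * t0 by nra.
  move=> /le_trans; apply.
  have -> : q%:R * nu (q%:R *: x - p%:V) ^+ 2 * t0
    = (q%:R * t0) * nu (q%:R *: x - p%:V) ^+ 2 by ring.
  rewrite ler_wpM2l //; first by nra.
  rewrite lerXn2r ?nnegrE ?norm_fun_ge0 //; first by apply: min_distZ2_ge0 => //; nra.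
  by apply: min_distZ2_le => //; nra.
by exists c => //; exists 1 => t /ltW; exact: BA_lower_bound.
Qed.

End BadlyApproximable.

Lemma BA_norm_independent {R : realType} (mu nu : 'rV[R]_2 -> R) :
  is_norm mu -> is_norm nu -> BA mu `<=` BA nu.
Proof.
move=> hmu hnu x /(BA_uniformP hmu)[c c0 hc]; apply/(BA_uniformP hnu).
have [C C0 hC] := norm_fun_le_sup hmu.
have [d d0 hd] := norm_fun_ge_sup hnu.
exists (c * (d / C) ^+ 2) => [|q p q1].
  by rewrite mulr_gt0 // exprn_gt0 // divr_gt0.
apply: le_trans (_ : (q%:R * mu (q%:R *: x - p%:V) ^+ 2) * (d / C) ^+ 2 <= _).
  by rewrite ler_wpM2r ?sqr_ge0 // hc.
rewrite -mulrA -exprMn ler_wpM2l // lerXn2r ?nnegrE ?norm_fun_ge0 //.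
  by rewrite mulr_ge0 ?norm_fun_ge0 // divr_ge0 // ltW.
set v := _ - _; rewrite mulrA ler_pdivrMr //.
by have := hC v; have := hd v; have := normr_ge0 v; nra.
Qed.

(** * Dirichlet's theorem *)
Section Dirichlet.
Context {R : realType}.

(** Pigeonhole: the N^2 + 1 points k x, for 0 <= k <= N^2, fall modulo Z^2 into
    N^2 boxes of side 1/N. *)
Lemma dirichlet_simultaneous (x : 'rV[R]_2) (N : nat) : (0 < N)%N ->
  exists (q : nat) (p : 'rV[int]_2),
    [/\ (1 <= q)%N, (q <= N ^ 2)%N & `|q%:R *: x - p%:V| <= N%:R^-1].
Proof.
case: N => // n _; set N := n.+1.
pose fr (a : R) := a - (Num.floor a)%:~R.
have fr01 a : 0 <= fr a < 1.
  by rewrite /fr subr_ge0 floor_le /= ltrBlDr addrC -intrD1 floorD1_gt.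
pose box (a : R) : 'I_n.+1 := inord (Num.truncn (N%:R * fr a)).
have N0 : 0 < N%:R :> R by rewrite ltr0n.
have boxP a b : box a = box b -> `|fr a - fr b| <= N%:R^-1.
  have lt_box c : (Num.truncn (N%:R * fr c) < n.+1)%N.
    have /andP[h0 h1] := fr01 c.
    by rewrite truncn_lt_nat; [rewrite gtr_pMr|rewrite mulr_ge0 // ltW].
  move=> /(congr1 val); rewrite /= !inordK // => e.
  have ge0 c : 0 <= N%:R * fr c by have /andP[h0 _] := fr01 c; rewrite mulr_ge0 // ltW.
  have /andP[a0 a1] := truncn_itv (ge0 a); have /andP[b0 b1] := truncn_itv (ge0 b).
  rewrite e in a0 a1; rewrite -natr1 in a1; rewrite -natr1 in b1.
  rewrite -[N%:R^-1]mul1r ler_pdivlMr // mulrC.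
  rewrite -[X in X * _](gtr0_norm N0) -normrM mulrBr ler_norml.
  by apply/andP; split; lra.
pose f (k : 'I_(N ^ 2).+1) := (box (k%:R * x 0 0), box (k%:R * x 0 1)).
have /injectivePn[i [j ij fij]] : ~~ injectiveb f.
  apply/negP => /injectiveP /leq_card; rewrite card_prod !card_ord.
  by rewrite mulnn ltnn.
wlog lt_ij : i j ij fij / (i < j)%N.
  move=> h; have [ltij|ltji|/val_inj e] := ltngtP i j; first exact: (h i j).
    by apply: (h j i) => //; rewrite eq_sym.
  by rewrite e eqxx in ij.
case: fij => /boxP e0 /boxP e1.
pose p : 'rV[int]_2 := \row_k (Num.floor (j%:R * x 0 k) - Num.floor (i%:R * x 0 k)).
have coord k : ((j - i)%N%:R *: x - p%:V) 0 k = fr (j%:R * x 0 k) - fr (i%:R * x 0 k).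
  by rewrite !mxE natrB ?(ltnW lt_ij) // intrB /fr; ring.
exists (j - i)%N, p; split; first by rewrite subn_gt0.
  by apply: leq_trans (leq_subr _ _) _; rewrite -ltnS.
by apply: sup_norm_le; rewrite coord distrC.
Qed.

(** This is what makes c_nu(x) finite, uniformly in x. *)
Lemma dirichlet_upper_bound (nu : 'rV[R]_2 -> R) : is_norm nu ->
  exists2 K : R, 0 < K & forall x t, 1 <= t -> t * min_distZ2 nu x t ^+ 2 <= K.
Proof.
move=> hnu; have [C C0 hC] := norm_fun_le_sup hnu.
exists (4 * C ^+ 2) => [|x t t1]; first by rewrite mulr_gt0 // exprn_gt0.
have t0 : 0 <= t by lra.
pose N := Num.truncn (Num.sqrt t).
have N1 : (0 < N)%N by rewrite truncn_gt0 -sqrtr1 ler_sqrt.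
have /andP[Nt tN] := truncn_itv (sqrtr_ge0 t); rewrite -/N in Nt tN.
have [q [p [q1 qN qp]]] := dirichlet_simultaneous x N1.
have N1R : 1 <= N%:R :> R by rewrite ler1n.
have st := sqr_sqrtr t0.
have qt : q%:R <= t.
  apply: (@le_trans _ _ (N ^ 2)%:R); first by rewrite ler_nat.
  by rewrite natrX -st lerXn2r ?nnegrE ?sqrtr_ge0 //; lra.
have hm := min_distZ2_le hnu x (t := t) p q1 qt.
have m0 := min_distZ2_ge0 hnu x t1.
have mN : N%:R * min_distZ2 nu x t <= C.
  apply: le_trans (_ : N%:R * (C * N%:R^-1) <= _); last first.
    by rewrite mulrCA mulfV ?mulr1 //; lra.
  rewrite ler_wpM2l ?ler0n //; apply: le_trans hm _.
  by apply: le_trans (hC _) _; rewrite ler_wpM2l //; exact: ltW.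
move: tN; rewrite -natr1 => tN.
have s0 := sqrtr_ge0 t.
have : Num.sqrt t * min_distZ2 nu x t <= 2 * C by nra.
have : 0 <= Num.sqrt t * min_distZ2 nu x t by exact: mulr_ge0.
move=> h0 h1; have -> : t * min_distZ2 nu x t ^+ 2 = (Num.sqrt t * min_distZ2 nu x t) ^+ 2.
  by rewrite exprMn st.
nra.
Qed.

End Dirichlet.

(** * Unimodular matrices close to singular ones *)
Section IntegerMatrices.

Lemma det3 (A : comNzRingType) (M : 'M[A]_3) :
  \det M = M 0 0 * (M 1 1 * M 2 2 - M 1 2 * M 2 1)
         - M 0 1 * (M 1 0 * M 2 2 - M 1 2 * M 2 0)
         + M 0 2 * (M 1 0 * M 2 1 - M 1 1 * M 2 0).
Proof.
pose m i j := M (inord i) (inord j).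
have mE i j : M i j = m i j by rewrite /m !inord_val.
rewrite (expand_det_row _ ord0) !big_ord_recl big_ord0 /cofactor.
rewrite !(expand_det_row _ ord0) !big_ord_recl !big_ord0 /cofactor !det_mx11 !mxE.
rewrite !mE /= !addr0.
rewrite /bump /= ?addn0 ?add0n /= !expr0 !expr1 ?expr2; ring.
Qed.

Lemma I3P (i : 'I_3) : [\/ i = 0, i = 1 | i = 2].
Proof.
by case: i => [[|[|[|//]]] h]; [apply: Or31|apply: Or32|apply: Or33]; apply/val_inj.
Qed.

Lemma sum3 (A : nmodType) (F : 'I_3 -> A) : \sum_i F i = F 0 + F 1 + F 2.
Proof.
rewrite !big_ord_recl big_ord0 addr0 addrA.
by congr (F _ + F _ + F _); apply/val_inj.
Qed.

Lemma det_mul_32_23 (A : comNzRingType) (X : 'M[A]_(3, 2)) (Y : 'M[A]_(2, 3)) :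
  \det (X *m Y) = 0.
Proof.
rewrite det3 !mxE !big_ord_recl !big_ord0; ring.
Qed.

(** A bounded perturbation of N * diag(1, c, 0) with determinant 1 for every N.
    The two large entries cannot contribute a term of order N^2 since the last
    diagonal entry is 0, and the bordering entries make the terms of order N
    cancel. *)
Definition unimodular_approx_diag (N c : int) : 'M[int]_3 :=
  \matrix_(i, j) nth 0 (nth [::]
    [:: [:: N; 0; -1]; [:: 0; N * c + 1; c]; [:: 1; 1; 0]] i) j.

Lemma det_unimodular_approx_diag N c : \det (unimodular_approx_diag N c) = 1.
Proof. rewrite det3 !mxE /=; ring. Qed.

(** In the Smith form G = L diag(d0, d1, d2) Q, singularity together with the
    divisibilities d0 | d1 | d2 forces d2 = 0, so that G is d0 times a matrix
    unimodularly equivalent to diag(1, c, 0). *)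
Lemma unimodular_near_singular_multiple (G : 'M[int]_3) : \det G = 0 -> G != 0 ->
  exists (d : int) (W : 'M[int]_3), d != 0 /\
    forall N : int, exists2 M : 'M[int]_3, M \in unitmx & d *: M = N *: G + W.
Proof.
move=> detG G0; have [L uL [Q uQ [d sd defG]]] := int_Smith_normal_form G.
set D := \matrix_(i, j) _ in defG.
have dvd k : (d`_k %| d`_k.+1)%Z.
  have [|ks] := ltnP k.+1 (size d); first by move: k; exact/sortedP.
  by rewrite [X in (_ %| X)%Z]nth_default ?dvdz0.
have /dvdzP[c d1E] := dvd 0%N; have /dvdzP[c' d2E] := dvd 1%N.
have d0 : d`_0 != 0.
  apply: contraNneq G0 => d0; rewrite defG (_ : D = 0) ?mulmx0 ?mul0mx //.
  apply/matrixP => i j; rewrite !mxE.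
  by case: (I3P i) => -> /=; rewrite ?d2E ?d1E d0 ?mulr0 mul0rn.
have d2 : d`_2 = 0.
  move: detG; rewrite defG !det_mulmx => /eqP.
  rewrite !mulf_eq0 => /orP[/orP[/eqP e|]|/eqP e].
  - by move: uL; rewrite unitmxE e unitr0.
  - rewrite det3 !mxE /= !mulr0n !mulr1n !mulr0 !mul0r ?subr0 ?addr0.
    rewrite !mulf_eq0 (negbTE d0) /= => /orP[/eqP d10|/eqP//].
    by rewrite d2E d10 mulr0.
  - by move: uQ; rewrite unitmxE e unitr0.
pose P : 'M[int]_3 := \matrix_(i, j) nth 0 (nth [::]
    [:: [:: 0; 0; -1]; [:: 0; 1; c]; [:: 1; 1; 0]] i) j.
exists d`_0, (d`_0 *: (L *m P *m Q)); split=> // N.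
exists (L *m unimodular_approx_diag N c *m Q).
  by rewrite !unitmx_mul uL uQ /= andbT unitmxE det_unimodular_approx_diag unitr1.
have -> : N *: G + d`_0 *: (L *m P *m Q) = L *m (N *: D + d`_0 *: P) *m Q.
  by rewrite mulmxDr mulmxDl -!scalemxAr -!scalemxAl defG.
rewrite scalemxAl scalemxAr.
congr (_ *m _ *m _); apply/matrixP => i j; rewrite !mxE.
by case: (I3P i) => ->; case: (I3P j) => -> /=;
  rewrite ?mulr1n ?mulr0n ?d1E ?d2; ring.
Qed.

End IntegerMatrices.

Section Approx.
Context {R : realType}.

Lemma large_nat (A : R) : exists2 n : nat, (0 < n)%N & A < n%:R.
Proof. by exists (Num.truncn A).+1 => //; exact: truncnS_gt. Qed.

Lemma floor_dist (K a : R) : 0 < K -> `|(Num.floor (K * a))%:~R / K - a| <= K^-1.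
Proof.
move=> K0; have h0 := floor_le (K * a); have h1 := floorD1_gt (K * a).
rewrite intrD1 in h1.
have Kz : K != 0 by rewrite gt_eqF.
rewrite -[X in _ - X](mulfK Kz) [a * K]mulrC -mulrBl normrM [`|K^-1|]gtr0_norm ?invr_gt0 //.
rewrite ger_pMl ?invr_gt0 // ler_norml; apply/andP; split; lra.
Qed.

(** Density form of the previous lemma: approximate the two factors by
    integer matrices over a common denominator K, which keeps the rank at most
    2, and let the multiplier N grow until the bounded error W is negligible. *)
Lemma unimodular_near_rank2 (X : 'M[R]_(3, 2)) (Y : 'M[R]_(2, 3)) (e S : R) : 0 < e ->
  exists (s : R) (M : 'M[int]_3), [/\ S < s, 0 < s, M \in unitmx &
    forall i j, `|(M i j)%:~R - s * (X *m Y) i j| <= e * s].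
Proof.
move=> e0.
pose A := `|X| + `|Y|.
have A0 : 0 <= A by rewrite addr_ge0.
have [K K0 hK] := large_nat (2 * (2 * (2 * A + 1)) / e).
have KR : 0 < K%:R :> R by rewrite ltr0n.
have KR1 : 1 <= K%:R :> R by rewrite ler1n.
pose Xk := map_mx (fun a : R => Num.floor (K%:R * a)) X.
pose Yk := map_mx (fun a : R => Num.floor (K%:R * a)) Y.
pose G := Xk *m Yk.
have approxG i j : `|(G i j)%:~R / K%:R ^+ 2 - (X *m Y) i j| <= e / 2.
  have term k : `|(Xk i k)%:~R / K%:R * ((Yk k j)%:~R / K%:R) - X i k * Y k j|
      <= (2 * A + 1) / K%:R.
    rewrite !mxE; set a := X i k; set b := Y k j.
    have ha := floor_dist a KR; have hb := floor_dist b KR.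
    set a' := _ / _ in ha *; set b' := _ / _ in hb *.
    have aA : `|a| <= A by apply: le_trans (mx_norm_coord X i k) _; rewrite lerDl.
    have bA : `|b| <= A by apply: le_trans (mx_norm_coord Y k j) _; rewrite lerDr.
    have -> : a' * b' - a * b = (a' - a) * (b' - b) + (a' - a) * b + a * (b' - b) by ring.
    have i1 : K%:R^-1 <= 1 :> R by rewrite invf_le1.
    apply: le_trans (ler_normD _ _) _; apply: le_trans (lerD (ler_normD _ _) (lexx _)) _.
    rewrite !normrM; move: ha hb aA bA i1.
    have : 0 <= K%:R^-1 :> R by rewrite invr_ge0 ltW.
    have := normr_ge0 (a' - a); have := normr_ge0 (b' - b).
    have := normr_ge0 a; have := normr_ge0 b.
    move: (`|a' - a|) (`|b' - b|) (`|a|) (`|b|) (K%:R^-1) => u v w z k1.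
    move=> *; have : u * v <= k1 by nra.
    have : u * z <= k1 * A by nra.
    have : w * v <= k1 * A by nra.
    by lra.
  rewrite !mxE !sum2 intrD !intrM.
  have -> : forall a b c d x y k : R, (a * b + c * d) / k ^+ 2 - (x + y) =
     ((a / k) * (b / k) - x) + ((c / k) * (d / k) - y).
    by move=> a b c d x y k; rewrite expr2 invfM; ring.
  apply: le_trans (ler_normD _ _) _.
  apply: le_trans (lerD (term 0) (term 1)) _.
  move: hK; rewrite ltr_pdivrMr // => hK.
  have -> : (2 * A + 1) / K%:R + (2 * A + 1) / K%:R = (2 * (2 * A + 1)) / K%:R by ring.
  by rewrite ler_pdivrMr //; lra.
(* If the integer approximation vanishes, the matrix to be approximated is
   itself below the error, and the identity matrix serves. *)
have [G0|G0] := eqVneq G 0.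
  have [n _ hn] := large_nat (Num.max S (2 / e)).
  exists n%:R, 1%:M.
  have [Sn en] : S < n%:R /\ 2 / e < n%:R by apply/andP; rewrite -gt_max.
  have n0 : 0 < n%:R :> R by apply: le_lt_trans en; rewrite divr_ge0 // ltW.
  split=> // [|i j]; first exact: unitmx1.
  have := approxG i j; rewrite G0 mxE mul0r sub0r normrN => h.
  apply: le_trans (ler_normB _ _) _; rewrite normrM [`|n%:R|]gtr0_norm //.
  have : `|(1%:M : 'M[int]_3) i j|%:~R <= 1 :> R.
    by rewrite mxE; case: (_ == _).
  rewrite intr_norm; rewrite ltr_pdivrMr // in en.
  by move: h; set z := `|(X *m Y) i j|; nra.
have [d [W [d0 hW]]] := unimodular_near_singular_multiple (det_mul_32_23 Xk Yk) G0.
pose w := `|map_mx intr W : 'M[R]_3|.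
have dR : 0 < `|d|%:~R :> R by rewrite ltr0z normr_gt0.
have dge1 : 1 <= `|d|%:~R :> R by rewrite ler1z -gtz0_ge1 normr_gt0.
pose kap : R := K%:R ^+ 2 / `|d|%:~R.
have kap0 : 0 < kap by rewrite divr_gt0 // exprn_gt0.
have [n n0 hn] := large_nat (Num.max S (2 * w / e) / kap).
(* The sign makes the scaling factor s positive. *)
have [M uM defM] := hW (n%:Z * sgz d).
exists (n%:R * kap), M.
move: hn; rewrite ltr_pdivrMr // gt_max => /andP[hS hw].
split=> // [|i j]; first by rewrite mulr_gt0 // ltr0n.
have Mij : (M i j)%:~R = n%:R * kap * ((G i j)%:~R / K%:R ^+ 2) + (W i j)%:~R / d%:~R :> R.
  have dz : d%:~R != 0 :> R by rewrite intr_eq0.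
  have := congr1 (fun B : 'M[int]_3 => (B i j)%:~R : R) defM; rewrite !mxE.
  rewrite !intrD !intrM => e1.
  apply: (mulfI dz); rewrite e1 mulrDr [X in _ = _ + X]mulrCA mulfV // mulr1.
  congr (_ + _).
  have -> : d%:~R = (sgz d)%:~R * `|d|%:~R :> R by rewrite -intrM -intEsg.
  have kz : K%:R != 0 :> R by rewrite gt_eqF.
  have dz' : `|d|%:~R != 0 :> R by rewrite gt_eqF.
  by rewrite /kap; field; rewrite kz dz'.
rewrite Mij; have -> : forall a b c f : R, c * a + b - c * f = c * (a - f) + b.
  by move=> *; ring.
apply: le_trans (ler_normD _ _) _.
have n0' : 0 <= n%:R * kap by rewrite mulr_ge0 ?ler0n // ltW.
rewrite [X in X + _]normrM [`|n%:R * kap|]ger0_norm //.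
have hWd : `|(W i j)%:~R / d%:~R| <= w :> R.
  rewrite normrM normfV -(intr_norm _ d) ler_pdivrMr //.
  have := mx_norm_coord (map_mx intr W : 'M[R]_3) i j; rewrite mxE -/w => h.
  by apply: le_trans h _; rewrite ler_peMr // normr_ge0.
have := approxG i j; rewrite ltr_pdivrMr // in hw.
by move: hWd; set z := `|_ - _|; nra.
Qed.

End Approx.

(** * Realising a cylinder-free lattice by a point of the plane *)
Section Lattices.
Context {R : realType}.

Definition horizontal (v : 'rV[R]_3) : 'rV[R]_2 :=
  \row_j v 0 (widen_ord (leqnSn 2) j).

Lemma horizontal0 v : horizontal v 0 0 = v 0 0.
Proof. by rewrite mxE; congr (v _ _); apply/val_inj. Qed.

Lemma horizontal1 v : horizontal v 0 1 = v 0 1.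
Proof. by rewrite mxE; congr (v _ _); apply/val_inj. Qed.

(** The lattice spanned by the rows of B avoids the open cylinder with base the
    open unit ball of nu and height coordinate in ]-1, 1[. *)
Definition admissible (nu : 'rV[R]_2 -> R) (B : 'M[R]_3) : Prop :=
  forall c : 'rV[int]_3, c != 0 ->
    1 <= nu (horizontal (c%:V *m B)) \/ 1 <= `|(c%:V *m B) 0 2|.

Definition frame_target (th : 'rV[R]_2) : 'M[R]_3 := \matrix_(i, j)
  nth 0 (nth [::] [:: [:: 1; 0; 0]; [:: 0; 1; 0]; [:: th 0 0; th 0 1; 0]] i) j.

Definition near_frame (th : 'rV[R]_2) (eta : R) (F : 'M[R]_3) : Prop :=
  forall i j, `|F i j - frame_target th i j| <= eta.

Lemma near_frame_coord th eta F : near_frame th eta F ->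
  [/\ [/\ `|F 0 0 - 1| <= eta, `|F 0 1| <= eta & `|F 0 2| <= eta],
      [/\ `|F 1 0| <= eta, `|F 1 1 - 1| <= eta & `|F 1 2| <= eta] &
      `|F 2 0 - th 0 0| <= eta /\ `|F 2 1 - th 0 1| <= eta].
Proof.
move=> h; have H i j : `|F i j - frame_target th i j| <= eta by exact: h.
by split; split; [have := H 0 0|have := H 0 1|have := H 0 2|have := H 1 0|
  have := H 1 1|have := H 1 2|have := H 2 0|have := H 2 1]; rewrite mxE /= ?subr0.
Qed.

(** Solving x F' = F'' by Cramer's rule, where F' is the upper left block of
    size 2 and F'' the lower left row of F: the horizontal part of a combination
    of the rows of F with coefficients (p, -q) is then (p - q x) F', so that the
    lattice of F is, up to the small distortion F', that of the point x. *)
Lemma near_frame_solve (F : 'M[R]_3) (th : 'rV[R]_2) (eta : R) :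
  eta <= 1 / 4 -> near_frame th eta F ->
  exists x : 'rV[R]_2,
  [/\ `|x - th| <= 2 * eta * (1 + 2 * `|th|),
      x 0 0 * F 0 0 + x 0 1 * F 1 0 = F 2 0,
      x 0 0 * F 0 1 + x 0 1 * F 1 1 = F 2 1,
      1 - 2 * eta <= F 0 0 * F 1 1 - F 0 1 * F 1 0 &
      \det F = (F 0 0 * F 1 1 - F 0 1 * F 1 0)
               * (F 2 2 - x 0 0 * F 0 2 - x 0 1 * F 1 2)].
Proof.
move=> e4 /near_frame_coord[[h00 h01 _] [h10 h11 _] [h20 h21]].
have e0 : 0 <= eta by apply: le_trans h01.
pose D := F 0 0 * F 1 1 - F 0 1 * F 1 0.
have D1 : 1 - 2 * eta <= D.
  move: h00 h01 h10 h11; rewrite !ler_norml /D => *.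
  have : F 0 1 * F 1 0 <= eta * eta by nra.
  have : (1 - eta) * (1 - eta) <= F 0 0 * F 1 1 by nra.
  nra.
have D0 : D != 0 by rewrite gt_eqF //; lra.
pose x : 'rV[R]_2 := \row_j if j == 0 then (F 2 0 * F 1 1 - F 2 1 * F 1 0) / D
                      else (F 0 0 * F 2 1 - F 0 1 * F 2 0) / D.
have x0E : x 0 0 = (F 2 0 * F 1 1 - F 2 1 * F 1 0) / D by rewrite mxE eqxx.
have x1E : x 0 1 = (F 0 0 * F 2 1 - F 0 1 * F 2 0) / D by rewrite mxE.
have eq0 : x 0 0 * F 0 0 + x 0 1 * F 1 0 = F 2 0.
  rewrite x0E x1E; apply: (mulIf D0).
  by rewrite /D; field; exact: D0.
have eq1 : x 0 0 * F 0 1 + x 0 1 * F 1 1 = F 2 1.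
  rewrite x0E x1E; apply: (mulIf D0).
  by rewrite /D; field; exact: D0.
exists x; split => //; last by rewrite det3 -eq0 -eq1; ring.
set d := x - th; have d0E : d 0 0 = x 0 0 - th 0 0 by rewrite !mxE.
have d1E : d 0 1 = x 0 1 - th 0 1 by rewrite !mxE.
have k0 : d 0 0 = (F 2 0 - th 0 0) - th 0 0 * (F 0 0 - 1) - th 0 1 * F 1 0
    - d 0 0 * (F 0 0 - 1) - d 0 1 * F 1 0 by rewrite -eq0 d0E d1E; ring.
have k1 : d 0 1 = (F 2 1 - th 0 1) - th 0 0 * F 0 1 - th 0 1 * (F 1 1 - 1)
    - d 0 0 * F 0 1 - d 0 1 * (F 1 1 - 1) by rewrite -eq1 d0E d1E; ring.
have prod (a b m : R) : `|a| <= m -> `|b| <= eta -> `|a * b| <= m * eta.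
  by move=> ha hb; rewrite normrM ler_pM.
have five (a b c f g A1 A2 A3 A4 A5 : R) : `|a| <= A1 -> `|b| <= A2 -> `|c| <= A3 ->
    `|f| <= A4 -> `|g| <= A5 -> `|a - b - c - f - g| <= A1 + A2 + A3 + A4 + A5.
  move=> h1 h2 h3 h4 h5; do 4!(apply: le_trans (ler_normB _ _) _; apply: lerD => //).
have t0 := mx_norm_coord th 0 0; have t1 := mx_norm_coord th 0 1.
have n0 := mx_norm_coord d 0 0; have n1 := mx_norm_coord d 0 1.
have : `|d| <= eta + `|th| * eta + `|th| * eta + `|d| * eta + `|d| * eta.
  apply: sup_norm_le.
    by rewrite {1}k0; apply: five => //; exact: prod.
  by rewrite {1}k1; apply: five => //; exact: prod.
have := normr_ge0 d; have := normr_ge0 th; nra.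
Qed.

Lemma int_unit_norm (z : int) : z \is a GRing.unit -> `|z%:~R| = 1 :> R.
Proof. by case/orP => /eqP ->; rewrite ?normrN1 // normr1. Qed.

(** The slack between r' and r makes this condition open in x. *)
Definition well_spaced (nu : 'rV[R]_2 -> R) (c T0 : R) : set 'rV[R]_2 :=
  [set x | exists T r r' : R, [/\ T0 < T, 0 < r', r' < r, c <= T * r' ^+ 2 &
    forall (q : nat) (p : 'rV[int]_2), (1 <= q)%N -> q%:R <= T ->
      r <= nu (q%:R *: x - p%:V)]].

Variables (nu : 'rV[R]_2 -> R) (hnu : is_norm nu).

Lemma well_spaced_open c T0 : 0 < T0 -> open (well_spaced nu c T0).
Proof.
move=> T00; have [C C0 hC] := norm_fun_le_sup hnu.
rewrite openE => x [T [r [r' [T0T r'0 rr' cT h]]]].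
have TC : 0 < T * C by rewrite mulr_gt0 //; exact: lt_trans T0T.
apply/nbhs_ballP; exists ((r - r') / 2 / (T * C)).
  by rewrite /= !divr_gt0 // subr_gt0.
move=> y; rewrite mx_norm_ball /ball_ /= ltr_pdivlMr // => hxy.
exists T, ((r + r') / 2), r'; split => //; first by lra.
move=> q p q1 qT; have := h q p q1 qT.
have : nu (q%:R *: (x - y)) <= (r - r') / 2.
  rewrite norm_fun_scale_pos // ?ler0n //.
  apply: le_trans (_ : T * (C * `|x - y|) <= _); last by lra.
  by rewrite ler_pM ?ler0n // norm_fun_ge0.
have := norm_fun_distl hnu (q%:R *: x - p%:V) (q%:R *: (x - y)).
have -> : q%:R *: x - p%:V - q%:R *: (x - y) = q%:R *: y - p%:V.
  by apply: row2P; rewrite !mxE; ring.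
by lra.
Qed.

(** The target frame times B^-1 has rank 2, so it is approximated by
    multiples of unimodular matrices M; multiply back by B. *)
Lemma unimodular_frame (B : 'M[R]_3) th eta S : \det B != 0 -> 0 < eta ->
  exists (s : R) (M : 'M[int]_3) (F : 'M[R]_3),
  [/\ S < s, 0 < s, M \in unitmx, map_mx intr M *m B = s *: F & near_frame th eta F].
Proof.
move=> detB eta0.
pose X : 'M[R]_(3, 2) := \matrix_(i, j)
  nth 0 (nth [::] [:: [:: 1; 0]; [:: 0; 1]; [:: th 0 0; th 0 1]] i) j.
pose J : 'M[R]_(2, 3) := \matrix_(i, j) ((i : nat) == j)%:R.
have XJ : X *m J = frame_target th.
  apply/matrixP => i j; rewrite mxE sum2 !mxE.
  by case: (I3P i) => ->; case: (I3P j) => -> /=; ring.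
have B1 : 0 < `|B| + 1 by have := normr_ge0 B; lra.
pose e := eta / (3 * (`|B| + 1)).
have e0 : 0 < e by rewrite divr_gt0 // mulr_gt0.
have [s [M [hS s0 uM hM]]] := unimodular_near_rank2 X (J *m invmx B) S e0.
have sz : s != 0 by rewrite gt_eqF.
exists s, M, (s^-1 *: (map_mx intr M *m B)); split => //.
  by rewrite scalerA mulfV // scale1r.
move=> i j; set F := _ *: _; rewrite -XJ.
have -> : F i j - (X *m J) i j =
    s^-1 * ((map_mx intr M - s *: (X *m (J *m invmx B))) *m B) i j.
  rewrite mulmxBl -scalemxAl -!mulmxA mulVmx ?mulmx1; last first.
    by rewrite unitmxE unitfE.
  by rewrite !mxE; field.
rewrite normrM gtr0_norm ?invr_gt0 // mulrC ler_pdivrMr //.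
rewrite mxE sum3.
have bnd l : `|(map_mx intr M - s *: (X *m (J *m invmx B))) i l * B l j|
    <= e * s * `|B|.
  rewrite normrM ler_pM ?normr_ge0 ?mx_norm_coord //.
  by have := hM i l; rewrite !mxE.
apply: le_trans (ler_normD _ _) _.
apply: le_trans (lerD (ler_normD _ _) (lexx _)) _.
apply: le_trans (lerD (lerD (bnd 0) (bnd 1)) (bnd 2)) _.
have -> : eta = e * (3 * (`|B| + 1)).
  by rewrite /e divfK // gt_eqF // mulr_gt0.
have := mulr_gt0 e0 s0; clear; lra.
Qed.

Lemma admissible_unimodular (M : 'M[int]_3) (B : 'M[R]_3) : M \in unitmx ->
  admissible nu B -> admissible nu (map_mx intr M *m B).
Proof.
move=> uM admB c c0; rewrite mulmxA -map_mxM; apply: admB.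
apply: contraNneq c0 => h.
by rewrite -[c]mulmx1 -(mulmxV uM) mulmxA h mul0mx.
Qed.

(** A lattice point of s F with coefficients (p, -q) has height
    s (y . f) - q s tau and horizontal part s y F', where y = p - q x and f is
    the upper part of the last column of F. As F' is close to the identity and f
    to 0, the first is at most om s nu(y) + q s |tau| and the second at most
    (1 + om) s nu(y) in norm. If s nu(y) < 1 - om, both would be less than 1. *)
Lemma frame_spacing (F : 'M[R]_3) th (x : 'rV[R]_2) s tau om eta C k :
  0 < s -> 0 < om -> om <= 1 / 2 -> 0 < C -> 0 < k -> 0 <= eta ->
  (forall y, nu y <= C * `|y|) -> (forall y, k * `|y| <= nu y) ->
  eta * (2 * (C + 1)) <= om * k ->
  near_frame th eta F -> admissible nu (s *: F) ->
  x 0 0 * F 0 0 + x 0 1 * F 1 0 = F 2 0 ->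
  x 0 0 * F 0 1 + x 0 1 * F 1 1 = F 2 1 ->
  tau = F 2 2 - x 0 0 * F 0 2 - x 0 1 * F 1 2 ->
  forall (q : nat) (p : 'rV[int]_2), (1 <= q)%N -> q%:R * (s * `|tau|) <= 1 - om ->
    (1 - om) / s <= nu (q%:R *: x - p%:V).
Proof.
move=> s0 om0 om2 C0 k0 eta0 hC hk etak nF admF x0 x1 tauE q p q1 qT.
have [[F00 F01 F02] [F10 F11 F12] _] := near_frame_coord nF.
rewrite leNgt; apply/negP => hlt.
pose y := p%:V - q%:R *: x.
have y0E : y 0 0 = (p 0 0)%:~R - q%:R * x 0 0 by rewrite !mxE.
have y1E : y 0 1 = (p 0 1)%:~R - q%:R * x 0 1 by rewrite !mxE.
have nuy : nu y * s < 1 - om.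
  by rewrite -ltr_pdivlMr // /y -opprB norm_funN.
pose c0 : 'rV[int]_3 := \row_j nth 0 [:: p 0 0; p 0 1; - q%:Z] j.
have c00 : c0 != 0.
  apply/eqP => /rowP/(_ 2); rewrite !mxE /= => /eqP.
  by rewrite oppr_eq0 -[0]/(0%:Z) eqz_nat => /eqP q0; rewrite q0 in q1.
have w0 : (c0%:V *m F) 0 0 = y 0 0 * F 0 0 + y 0 1 * F 1 0.
  by rewrite y0E y1E mxE sum3 !mxE /= -x0 intrN; ring.
have w1 : (c0%:V *m F) 0 1 = y 0 0 * F 0 1 + y 0 1 * F 1 1.
  by rewrite y0E y1E mxE sum3 !mxE /= -x1 intrN; ring.
have w2 : (c0%:V *m F) 0 2 = y 0 0 * F 0 2 + y 0 1 * F 1 2 - q%:R * tau.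
  by rewrite y0E y1E mxE sum3 !mxE /= intrN tauE; ring.
have adm := admF _ c00; rewrite -scalemxAr in adm.
clearbody y c0; clear admF x0 x1 tauE hlt y0E y1E nF c00.
have n0 := mx_norm_coord y 0 0; have n1 := mx_norm_coord y 0 1.
have yk := hk y; have yn := normr_ge0 y; have ny0 := norm_fun_ge0 hnu y.
have prod (a b : R) : `|a| <= `|y| -> `|b| <= eta -> `|a * b| <= `|y| * eta.
  by move=> ha hb; rewrite normrM ler_pM.
have two (a b : R) : `|a| <= `|y| * eta -> `|b| <= `|y| * eta -> `|a + b| <= 2 * eta * `|y|.
  move=> ha hb; apply: le_trans (ler_normD _ _) (le_trans (lerD ha hb) _).
  by rewrite -mulrA mulr_natl mulr2n [eta * _]mulrC.
have ey : 2 * eta * (C + 1) * `|y| <= om * nu y.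
  have := ler_wpM2r yn etak; have := ler_wpM2l (ltW om0) yk; clear; lra.
have e2 : 0 <= 2 * eta * `|y| by rewrite !mulr_ge0.
case: adm.
  apply/negP; rewrite -ltNge.
  have -> : horizontal (s *: (c0%:V *m F)) = s *: (y + (horizontal (c0%:V *m F) - y)).
    rewrite addrC subrK; apply: row2P; rewrite [RHS]mxE ?horizontal0 ?horizontal1.
      by rewrite mxE.
    by rewrite mxE.
  rewrite norm_fun_scale_pos ?ltW //.
  set z := _ - y.
  have hz : `|z| <= 2 * eta * `|y|.
    apply: sup_norm_le; rewrite /z mxE [X in _ + X]mxE.
      rewrite horizontal0 w0.
      have -> : forall a b f g : R, a * f + b * g - a = a * (f - 1) + b * g by move=> *; ring.
      by apply: two; apply: prod.
    rewrite horizontal1 w1.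
    have -> : forall a b f g : R, a * f + b * g - b = a * f + b * (g - 1) by move=> *; ring.
    by apply: two; apply: prod.
  have tri := is_norm_triangle hnu y z; have hCz := hC z.
  have Cz : C * `|z| <= C * (2 * eta * `|y|) by rewrite ler_pM2l.
  have tri' : nu (y + z) <= nu y * (1 + om).
    by move: tri hCz Cz e2 ey; clear; lra.
  have : s * nu (y + z) <= s * (nu y * (1 + om)) by rewrite ler_pM2l.
  by move: nuy om0 om2; clear; nra.
apply/negP; rewrite -ltNge [X in `|X|]mxE w2 normrM gtr0_norm //.
have h1 : `|y 0 0 * F 0 2 + y 0 1 * F 1 2| <= 2 * eta * `|y|.
  by apply: two; apply: prod.
have tri := ler_normB (y 0 0 * F 0 2 + y 0 1 * F 1 2) (q%:R * tau).
have qtau : `|q%:R * tau| = q%:R * `|tau| by rewrite normrM ger0_norm ?ler0n.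
rewrite qtau in tri.
have ey' : 2 * eta * `|y| <= om * nu y.
  have := mulr_ge0 e2 (ltW C0); move: ey; clear; lra.
apply: le_lt_trans (_ : s * (om * nu y + q%:R * `|tau|) < _).
  by rewrite ler_pM2l //; move: tri h1 ey'; clear; lra.
have hom : om * (nu y * s) < om * 1.
  by rewrite ltr_pM2l //; move: nuy om0; clear; lra.
by move: qT hom; clear; lra.
Qed.

(** The scale s and the height tau enter the product of time and squared
    distance only through s^2 tau, which is D / (s del), with del close to 1,
    once the determinant s^3 del tau of the frame is known to be D. *)
Lemma spacing_numerics (om c D T0 s del tau : R) :
  0 < om -> om <= 1 / 2 -> om <= (1 - c * D) / 6 -> 0 < D -> 1 < s ->
  T0 * D / (1 - om) ^+ 2 < s -> 1 - om <= del -> 0 < tau -> s ^+ 3 * (del * tau) = D ->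
  T0 < (1 - om) / (s * tau) /\ c <= (1 - om) / (s * tau) * ((1 - om) ^+ 2 / s) ^+ 2.
Proof.
move=> om0 om2 om6 D0 s1 sT domdel tau0 stau.
have s0 : 0 < s by apply: lt_trans s1.
have o1 : 0 < 1 - om by move: om2; clear; lra.
have del0 : 0 < del by apply: lt_le_trans domdel.
have TE : (1 - om) / (s * tau) = (1 - om) * s ^+ 2 * del / D.
  by rewrite -stau; field; rewrite !gt_eqF.
rewrite TE; split.
  rewrite ltr_pdivlMr //; move: sT; rewrite ltr_pdivrMr ?exprn_gt0 // => sT.
  apply: lt_le_trans sT _.
  have s2 : s <= s ^+ 2 by rewrite expr2 ler_peMr // ltW.
  have o2 : (1 - om) ^+ 2 <= (1 - om) * del by rewrite expr2 ler_pM2l.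
  have -> : (1 - om) * s ^+ 2 * del = s ^+ 2 * ((1 - om) * del) by ring.
  by rewrite ler_pM // ?ltW // exprn_gt0.
have -> : (1 - om) * s ^+ 2 * del / D * ((1 - om) ^+ 2 / s) ^+ 2
    = (1 - om) ^+ 5 * del / D.
  by field; rewrite !gt_eqF.
rewrite ler_pdivlMr //.
apply: le_trans (_ : (1 - om) ^+ 5 * (1 - om) <= _); last first.
  by rewrite ler_pM2l ?exprn_gt0.
have -> : (1 - om) ^+ 5 * (1 - om) = (1 - om) ^+ 2 * (1 - om) ^+ 2 * (1 - om) ^+ 2.
  by ring.
have p2 : 1 - 2 * om <= (1 - om) ^+ 2 by have := sqr_ge0 om; clear; lra.
have p1 : (1 - om) ^+ 2 <= 1.
  by rewrite expr2; move: om0 om2; clear; nra.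
move: (sqr_ge0 (1 - om)) p1 p2; set w := (1 - om) ^+ 2 => w0 w1 p2.
have w2 : 1 - 4 * om <= w * w by move: w0 p2 om0 om2; clear; nra.
have w3 : (1 - 4 * om) * w <= w * w * w by rewrite ler_wpM2r.
move: w0 w1 p2 w3 om0 om6; clear => w0 w1 p2 w3 om0 om6.
have [h|h] := leP 0 (1 - 4 * om); last by nra.
by have := ler_wpM2l h p2; have := sqr_ge0 om; lra.
Qed.

(** Only the covolume of the lattice matters: its orientation relative to the
    plane is absorbed by the choice of basis. *)
Lemma well_spaced_dense (B : 'M[R]_3) c T0 : admissible nu B -> \det B != 0 ->
  c * `|\det B| < 1 -> dense (well_spaced nu c T0).
Proof.
move=> admB detB cD O [th Oth] oO.
have [u u0 hu] : exists2 u, 0 < u & forall y, `|y - th| < u -> O y.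
  have /nbhs_ballP[u u0 hu] : nbhs th O by exact: open_nbhs_nbhs.
  exists u => // y yu; apply: hu; rewrite mx_norm_ball /ball_ /=.
  by rewrite distrC.
set D := `|\det B| in cD.
have D0 : 0 < D by rewrite normr_gt0.
have [C C0 hC] := norm_fun_le_sup hnu.
have [k k0 hk] := norm_fun_ge_sup hnu.
pose om := Num.min (1 / 2) ((1 - c * D) / 6).
have om0 : 0 < om by rewrite lt_min; apply/andP; split; lra.
have om2 : om <= 1 / 2 by rewrite ge_min lexx.
have om6 : om <= (1 - c * D) / 6 by rewrite ge_min lexx orbT.
clearbody om.
pose eta := Num.min (Num.min (1 / 4) (om / 2)) (Num.min (om * k / (2 * (C + 1)))
  (u / (4 * (1 + 2 * `|th|)))).
have th1 : 0 < 1 + 2 * `|th| by have := normr_ge0 th; lra.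
have C1 : 0 < C + 1 by lra.
have eta0 : 0 < eta.
  rewrite !lt_min; apply/andP; split; apply/andP; split; first lra; first lra.
    by rewrite divr_gt0 // mulr_gt0.
  by rewrite divr_gt0 // mulr_gt0.
have [eta4 etaom] : eta <= 1 / 4 /\ eta <= om / 2.
  by split; rewrite /eta !ge_min lexx ?orbT.
have etak : eta * (2 * (C + 1)) <= om * k.
  by rewrite -ler_pdivlMr ?mulr_gt0 // /eta !ge_min lexx ?orbT.
have etau : eta * (4 * (1 + 2 * `|th|)) <= u.
  by rewrite -ler_pdivlMr ?mulr_gt0 // /eta !ge_min lexx ?orbT.
clearbody eta.
have [s [M [F [hS s0 uM MBF nF]]]] :=
  unimodular_frame th (Num.max 1 (T0 * D / (1 - om) ^+ 2)) detB eta0.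
have [x [xth x0 x1 del detF]] := near_frame_solve eta4 nF.
exists x; split.
  apply: hu; apply: le_lt_trans xth _; apply: lt_le_trans etau.
  by have := mulr_gt0 eta0 th1; clear; lra.
set del' := F 0 0 * F 1 1 - F 0 1 * F 1 0 in del detF.
set tau := F 2 2 - x 0 0 * F 0 2 - x 0 1 * F 1 2 in detF.
have admF : admissible nu (s *: F) by rewrite -MBF; exact: admissible_unimodular.
have domdel : 1 - om <= del' by move: del etaom; clear; lra.
have del0 : 0 < del' by apply: lt_le_trans domdel; move: om2; clear; lra.
have stau : s ^+ 3 * (del' * `|tau|) = D.
  have : `|\det (s *: F)| = D.
    rewrite -MBF det_mulmx normrM det_map_mx.
    by rewrite int_unit_norm ?mul1r // -unitmxE.
  by rewrite detZ detF normrM normrX (gtr0_norm s0) normrM (gtr0_norm del0).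
have tau0 : 0 < `|tau|.
  rewrite lt_def normr_ge0 andbT; apply/negP => /eqP t0.
  by move: D0; rewrite -stau t0 !mulr0 ltxx.
move: hS; rewrite gt_max => /andP[s1 sT].
have [hT0 hcT] := spacing_numerics om0 om2 om6 D0 s1 sT domdel tau0 stau.
have o1 : 0 < 1 - om by move: om2; clear; lra.
exists ((1 - om) / (s * `|tau|)), ((1 - om) / s), ((1 - om) ^+ 2 / s).
split => // [||q p q1 qT]; first by rewrite divr_gt0 // exprn_gt0.
  by rewrite ltr_pM2r ?invr_gt0 // expr2 gtr_pMl // gtrBl.
apply: (frame_spacing s0 om0 om2 C0 k0 (ltW eta0) hC hk etak nF admF x0 x1) => //.
by move: qT; rewrite ler_pdivlMr // mulr_gt0.
Qed.

(** Baire's theorem in the plane: a point in the intersection over n of the sets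
    of points well spaced at some time beyond n. *)
Lemma approx_limsup_ge_of_admissible (B : 'M[R]_3) c : admissible nu B -> \det B != 0 ->
  0 < c -> c * `|\det B| < 1 -> exists x, (c%:E <= approx_limsup nu x)%E.
Proof.
move=> admB detB c0 cD.
(* The plane as a complete normed module, from its two structures. *)
pose plane : completeNormedModType R :=
  HB.pack 'rV[R]_2 (Complete.on 'rV[R]_2) (NormedModule.on 'rV[R]_2).
have [||x [_ hx]] := @Baire R plane (fun n => well_spaced nu c n.+1%:R) _
    setT _ openT.
- move=> n; split; first by apply: well_spaced_open; rewrite ltr0n.
  exact: well_spaced_dense admB detB cD.
- by exists 0.
exists x; apply: limsup_pinfty_ge => A.
have [n n0 An] := large_nat A.
have [T [r [r' [nT r'0 rr' cT h]]]] := hx n I.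
have n1T : n.+1%:R <= T by exact: ltW.
exists T; first by apply: lt_le_trans n1T; rewrite -natr1; lra.
have T1 : 1 <= T by apply: le_trans n1T; rewrite ler1n.
apply: le_trans cT _; rewrite ler_wpM2l //; first lra.
have rm : r <= min_distZ2 nu x T by apply: min_distZ2_ge.
by rewrite lerXn2r ?nnegrE; lra.
Qed.

End Lattices.

(** * Badly approximable points are not extremal *)
Section Perturbation.
Context {R : realType} (nu : 'rV[R]_2 -> R) (hnu : is_norm nu).

(** The key step: the lattice of a badly approximable point at time T can be
    compressed in the vertical direction by a factor 1 - eps independent of T,
    if a shear is added that keeps the only endangered point out of the
    cylinder. *)
Lemma improved_lattice x : BA nu x ->
  exists2 eps : R, 0 < eps < 1 & exists T0 : R, forall T, T0 < T ->
    exists2 B : 'M[R]_3, admissible nu B &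
      \det B = (1 - eps) / (T * min_distZ2 nu x T ^+ 2).
Proof.
move=> /(BA_uniformP hnu)[c c0 hc].
have [K K0 hK] := dirichlet_upper_bound hnu.
have [C C0 hC] := norm_fun_le_sup hnu.
have [k k0 hk] := norm_fun_ge_sup hnu.
(* delta is the thickness of the slab above height 1 in which two distinct
   lattice points over the unit ball would contradict bad approximability. *)
pose delta := c / (8 * K).
have K8 : 0 < 8 * K by rewrite mulr_gt0.
have d0 : 0 < delta by rewrite divr_gt0.
have cE : c = 8 * K * delta by rewrite /delta mulrCA mulfV ?mulr1 // gt_eqF.
have d1 : delta <= 1.
  rewrite ler_pdivrMr // mul1r.
  by have := hK x 1 (lexx _); have := BA_lower_bound hnu c0 hc (lexx _); lra.
(* eps * L bounds the shear form l over the unit ball. *)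
pose L := 4 * C / (k * delta).
have kd0 : 0 < k * delta by exact: mulr_gt0.
have L0 : 0 < L by rewrite divr_gt0 // mulr_gt0.
pose eps := delta / (1 + delta + L).
have s0 : 0 < 1 + delta + L by lra.
have e0 : 0 < eps by exact: divr_gt0.
have eE : eps * (1 + delta + L) = delta by rewrite /eps divfK // gt_eqF.
have e1 : eps < 1 by rewrite ltr_pdivrMr //; lra.
exists eps; first by rewrite e0.
exists (Num.max 1 (4 * K / k ^+ 2)) => T; rewrite gt_max => /andP[T1 Tk].
have T0 : 0 < T by lra.
set r := min_distZ2 nu x T.
have r0 : 0 <= r by apply: min_distZ2_ge0 => //; exact: ltW.
have rK : T * r ^+ 2 <= K by apply: hK; exact: ltW.
have rc : c <= T * r ^+ 2 by apply: BA_lower_bound => //; exact: ltW.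
have {}r0 : 0 < r.
  rewrite lt_def r0 andbT; apply: contraTneq rc => ->.
  by rewrite expr0n mulr0 -ltNge.
have rz : r != 0 by rewrite gt_eqF.
have Tz : T != 0 by rewrite gt_eqF.
have rk : 2 * r < k.
  move: Tk; rewrite ltr_pdivrMr ?exprn_gt0 // => Tk.
  have : 4 * r ^+ 2 < k ^+ 2 by nra.
  by rewrite !expr2; nra.
have int_far (p : 'rV[int]_2) : p != 0 -> 2 * r < nu p%:V.
  move=> p0; apply: lt_le_trans rk _; apply: le_trans (hk _).
  by rewrite ler_peMr ?int_vec_norm_ge1 // ltW.
have far (q : nat) (p : 'rV[int]_2) : (1 <= q)%N -> c <= q%:R * nu (p%:V + q%:R *: x) ^+ 2.
  by move=> q1; have := hc q (- p) q1; rewrite map_mxN opprK addrC.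
pose near (p : 'rV[int]_2) (q : nat) :=
  [/\ T < q%:R, q%:R < (1 + delta) * T & nu (p%:V + q%:R *: x) < r].
(* The difference of two points in the slab has height less than delta and
   horizontal norm less than 2. *)
have near_uniq p q p' q' : near p q -> near p' q' -> p = p' /\ q = q'.
  wlog qq' : p q p' q' / (q <= q')%N.
    move=> h; case: (leqP q q') => [|/ltnW] le n1 n2; first exact: h.
    by have [-> ->] := h _ _ _ _ le n2 n1.
  move=> [q1 q2 q3] [q1' q2' q3'].
  have dist : nu ((p' - p)%:V + (q' - q)%:R *: x) < 2 * r.
    have -> : (p' - p)%:V + (q' - q)%:R *: x
        = (p'%:V + q'%:R *: x) - (p%:V + q%:R *: x).
      by apply: row2P; rewrite !mxE natrB // intrB; ring.
    by apply: le_lt_trans (norm_funB hnu _ _) _; lra.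
  have [e|nq] := eqVneq q q'.
    split=> //; apply/eqP; rewrite eq_sym -subr_eq0; apply: contraTT dist => p0.
    by rewrite -leNgt e subnn scale0r addr0 ltW // int_far.
  have dq : (1 <= q' - q)%N by rewrite subn_gt0 ltn_neqAle nq.
  have := far _ (p' - p) dq; rewrite leNgt => /negP[].
  rewrite natrB // cE.
  have n0 := norm_fun_ge0 hnu ((p' - p)%:V + (q' - q)%:R *: x).
  move: dist n0; rewrite natrB //; set u := nu _ => dist n0.
  have u4 : u ^+ 2 <= 4 * r ^+ 2 by rewrite !expr2; nra.
  have qd : q'%:R - q%:R < delta * T :> R by lra.
  have qd0 : 0 <= q'%:R - q%:R :> R by rewrite subr_ge0 ler_nat.
  apply: le_lt_trans (_ : delta * T * (4 * r ^+ 2) < _).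
    by rewrite ler_pM ?sqr_ge0 // ltW.
  have : delta * (T * r ^+ 2) <= delta * K by rewrite ler_pM2l.
  by have := mulr_gt0 K0 d0; lra.
(* l is 0 when the slab contains no point, and otherwise the multiple of the
   inner product with w that takes the value eps at w. *)
have [l [hl lnear]] : exists l : 'rV[R]_2,
    (forall y, nu y < 1 -> `|l 0 0 * y 0 0 + l 0 1 * y 0 1| <= eps * L) /\
    (forall p q y, near p q -> y = r^-1 *: (p%:V + q%:R *: x) ->
       l 0 0 * y 0 0 + l 0 1 * y 0 1 = eps).
  have [[p [q npq]]|no] := pselect (exists p q, near p q); last first.
    exists 0; split=> [y _|p q y npq]; last by exfalso; apply: no; exists p, q.
    by rewrite !mxE !mul0r addr0 normr0 mulr_ge0 // ltW.
  pose w := r^-1 *: (p%:V + q%:R *: x).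
  have [q1 q2 q3] := npq.
  have nuw : delta <= nu w.
    rewrite /w norm_fun_scale_pos ?invr_ge0 ?(ltW r0) // mulrC ler_pdivlMr //.
    have : (1 <= q)%N by rewrite -(ler_nat R); lra.
    move=> /far; move/(_ p); set u := nu _ => hu.
    have u0 : 0 <= u by exact: norm_fun_ge0.
    have : c <= 2 * T * u ^+ 2.
      apply: le_trans hu _; rewrite ler_wpM2r ?sqr_ge0 //.
      by apply: ltW; apply: lt_le_trans q2 _; rewrite ler_pM2r //; lra.
    move=> hu2; have h4 : T * (4 * delta * r ^+ 2) <= T * u ^+ 2.
      have : delta * (T * r ^+ 2) <= delta * K by rewrite ler_pM2l.
      by rewrite cE in hu2; lra.
    rewrite ler_pM2l // in h4.
    rewrite -(ler_pXn2r (n := 2)) ?nnegrE //; last by rewrite mulr_ge0 ?ltW.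
    apply: le_trans h4; rewrite exprMn ler_wpM2r ?sqr_ge0 // expr2; nra.
  have wn : delta / C <= `|w| by rewrite ler_pdivrMr // mulrC; exact: le_trans (hC w).
  pose S := w 0 0 ^+ 2 + w 0 1 ^+ 2.
  have wS : `|w| ^+ 2 <= 2 * S.
    have : `|w| <= `|w 0 0| + `|w 0 1|.
      by apply: sup_norm_le; rewrite ?lerDl ?lerDr.
    rewrite /S -[w 0 0 ^+ 2]real_normK ?num_real // -[w 0 1 ^+ 2]real_normK ?num_real //.
    have := normr_ge0 w; have := normr_ge0 (w 0 0); have := normr_ge0 (w 0 1).
    set a := `|w|; set b := `|w 0 0|; set b' := `|w 0 1| => *.
    have : a ^+ 2 <= (b + b') ^+ 2 by rewrite !expr2; nra.
    by have := sqr_ge0 (b - b'); rewrite !expr2; lra.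
  have w0 : 0 < `|w| by apply: lt_le_trans wn; exact: divr_gt0.
  have S0 : 0 < S by have : 0 < `|w| ^+ 2 by [rewrite exprn_gt0]; lra.
  have lE y : ((eps / S) *: w) 0 0 * y 0 0 + ((eps / S) *: w) 0 1 * y 0 1
      = eps * ((w 0 0 * y 0 0 + w 0 1 * y 0 1) / S).
    by rewrite [X in X * _]mxE [X in _ + X * _]mxE; ring.
  exists ((eps / S) *: w); split=> [y y1|p' q' y n' ->]; last first.
    have [<- <-] := near_uniq _ _ _ _ npq n'.
    by rewrite -/w lE -!expr2 -/S mulfV ?mulr1 // gt_eqF.
  rewrite lE normrM [`|eps|]gtr0_norm // ler_pM2l //.
  rewrite normrM [`|S^-1|]gtr0_norm ?invr_gt0 // ler_pdivrMr //.
  have y0 := normr_ge0 y; have ky := hk y.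
  have yk : `|y| * k <= 1 by lra.
  have h1 : `|w 0 0 * y 0 0 + w 0 1 * y 0 1| <= 2 * `|w| * `|y|.
    apply: le_trans (ler_normD _ _) _; rewrite !normrM.
    have m i : `|w 0 i| * `|y 0 i| <= `|w| * `|y|.
      by rewrite ler_pM // mx_norm_coord.
    by have := m 0; have := m 1; lra.
  apply: le_trans h1 _.
  apply: le_trans (_ : L * (`|w| ^+ 2 / 2) <= _); last by rewrite ler_pM2l //; lra.
  have -> : 2 * `|w| * `|y| = 2 * `|y| * `|w| by ring.
  have -> : L * (`|w| ^+ 2 / 2) = L / 2 * `|w| * `|w| by rewrite expr2; ring.
  rewrite ler_pM2r //.
  apply: le_trans (_ : L / 2 * (delta / C) <= _); last by rewrite ler_pM2l // divr_gt0.
  have -> : L / 2 * (delta / C) = 2 / k.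
    by rewrite /L; field; rewrite !gt_eqF.
  by rewrite ler_pdivlMr //; lra.
pose B : 'M[R]_3 := \matrix_(i, j) nth 0 (nth [::]
  [:: [:: r^-1; 0; l 0 0 / r]; [:: 0; r^-1; l 0 1 / r];
      [:: x 0 0 / r; x 0 1 / r;
        (1 - eps) / T + (l 0 0 * x 0 0 + l 0 1 * x 0 1) / r]] i) j.
exists B; last first.
  by rewrite det3 !mxE /=; field; rewrite Tz rz.
move=> a a0.
wlog a2 : a a0 / 0 <= a 0 2.
  move=> h; have [|/ltW a2] := leP 0 (a 0 2); first exact: h.
  have := h (- a); rewrite oppr_eq0 mxE oppr_ge0 => /(_ a0 a2).
  rewrite map_mxN mulNmx mxE normrN.
  have -> : horizontal (- (a%:V *m B)) = - horizontal (a%:V *m B).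
    by apply: row2P; rewrite !mxE.
  by rewrite norm_funN.
pose q := absz (a 0 2).
have qE : a 0 2 = q%:Z by rewrite /q gez0_abs.
pose p : 'rV[int]_2 := \row_j a 0 (widen_ord (leqnSn 2) j).
have p0E : p 0 0 = a 0 0 by rewrite mxE; congr (a _ _); apply/val_inj.
have p1E : p 0 1 = a 0 1 by rewrite mxE; congr (a _ _); apply/val_inj.
pose y := r^-1 *: (p%:V + q%:R *: x).
have y0E : y 0 0 = ((a 0 0)%:~R + q%:R * x 0 0) / r.
  by rewrite mxE [X in _ * X]mxE [X in _ * (X + _)]mxE p0E mxE mulrC.
have y1E : y 0 1 = ((a 0 1)%:~R + q%:R * x 0 1) / r.
  by rewrite mxE [X in _ * X]mxE [X in _ * (X + _)]mxE p1E mxE mulrC.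
have -> : horizontal (a%:V *m B) = y.
  apply: row2P; first by rewrite y0E horizontal0 mxE sum3 !mxE /= qE; ring.
  by rewrite y1E horizontal1 mxE sum3 !mxE /= qE; ring.
have -> : (a%:V *m B) 0 2 = (1 - eps) * (q%:R / T) + (l 0 0 * y 0 0 + l 0 1 * y 0 1).
  by rewrite y0E y1E mxE sum3 !mxE /= qE; ring.
have nuy : nu y = nu (p%:V + q%:R *: x) / r.
  by rewrite /y norm_fun_scale_pos ?invr_ge0 ?(ltW r0) // mulrC.
have [|y1] := leP 1 (nu y); [by left|right].
have ylt : nu (p%:V + q%:R *: x) < r.
  by move: y1; rewrite nuy ltr_pdivrMr // mul1r.
have [q0|qpos] := posnP q.
  exfalso; move: ylt; rewrite q0 scale0r addr0; apply/negP; rewrite -leNgt.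
  have pz : p != 0.
    apply: contraNneq a0 => pz; apply/eqP/rowP => i; rewrite !mxE.
    case: (I3P i) => ->; first by rewrite -p0E pz mxE.
      by rewrite -p1E pz mxE.
    by rewrite qE q0.
  by have := int_far _ pz; lra.
have [qT|Tq] := leP q%:R T.
  exfalso; move: ylt; apply/negP; rewrite -leNgt.
  have := min_distZ2_le hnu x (- p) qpos qT.
  by rewrite map_mxN opprK addrC.
apply: le_trans (ler_norm _).
have qT1 : 1 < q%:R / T by rewrite ltr_pdivlMr // mul1r.
have [qd|qd] := ltP q%:R ((1 + delta) * T).
  rewrite (lnear p q) //.
  have : 0 < (1 - eps) * (q%:R / T - 1) by rewrite mulr_gt0 // subr_gt0.
  by lra.
have qd' : 1 + delta <= q%:R / T by rewrite ler_pdivlMr.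
have := hl y y1; rewrite ler_norml => /andP[h _].
have : 0 <= (1 - eps) * (q%:R / T - (1 + delta)) by rewrite mulr_ge0 // subr_ge0 // ltW.
by lra.
Qed.

(** A time T at which T r(T)^2 exceeds (1 - eps) c_nu(x) yields a compressed
    lattice of covolume less than 1 / c_nu(x). *)
Lemma BA_sub_DI : BA nu `<=` DI nu.
Proof.
move=> x BAx; have [eps /andP[e0 e1] [T0 hB]] := improved_lattice BAx.
have [c c0 hc] := (BA_uniformP hnu x).1 BAx.
have [K K0 hK] := dirichlet_upper_bound hnu.
have leK : (approx_limsup nu x <= K%:E)%E.
  by apply: (limsup_pinfty_le (A := 1)) => t /ltW; exact: hK.
have gec : (c%:E <= approx_limsup nu x)%E.
  apply: limsup_pinfty_ge => A; exists (Num.max A 1 + 1).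
    by apply: le_lt_trans (_ : Num.max A 1 < _); rewrite ?le_max ?lexx // ltrDl.
  apply: BA_lower_bound => //.
  by have : 1 <= Num.max A 1 by [rewrite le_max lexx orbT]; lra.
have [k kE] : exists k, approx_limsup nu x = k%:E.
  case: (approx_limsup nu x) leK gec => [k _ _|//|//]; by exists k.
rewrite kE lee_fin in gec.
have k0 : 0 < k by lra.
have lt : (((1 - eps) * k)%:E < approx_limsup nu x)%E.
  by rewrite kE lte_fin gtr_pMl //; lra.
have [T T0T hT] := limsup_pinfty_gt lt T0.
have [B admB detB] := hB T T0T.
set m := T * _ in hT detB.
have m0 : 0 < m by apply: lt_trans hT; rewrite mulr_gt0 //; lra.
have eB : \det B != 0 by rewrite detB gt_eqF // divr_gt0 //; lra.
have dB : `|\det B| = (1 - eps) / m by rewrite detB gtr0_norm // divr_gt0 //; lra.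
have ltk : k < m / (1 - eps) by rewrite ltr_pdivlMr; lra.
have [c' /andP[kc' c'm]] : exists c', k < c' < m / (1 - eps).
  by exists ((k + m / (1 - eps)) / 2); rewrite midf_lt // midf_lt.
have c'0 : 0 < c' by lra.
have [|x' hx'] := approx_limsup_ge_of_admissible hnu admB eB c'0.
  rewrite dB mulrA ltr_pdivrMr // mul1r -ltr_pdivlMr //; lra.
rewrite /DI /= kE; apply: (@lt_le_trans _ _ c'%:E); first by rewrite lte_fin.
by apply: le_trans hx' _; apply: ereal_sup_ubound; exists x'.
Qed.

End Perturbation.

(** * Rational points in small Euclidean balls *)
Section Euclidean.
Context {R : realType}.
Implicit Types (v w x y : 'rV[R]_2).

Lemma enorm2E v : enorm v = Num.sqrt (v 0 0 ^+ 2 + v 0 1 ^+ 2).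
Proof. by rewrite /enorm sum2. Qed.

Lemma enorm_is_norm : is_norm (@enorm R 2).
Proof.
split=> [x y|a x|x]; rewrite ?enorm2E.
- rewrite [(x + y) 0 0]mxE [(x + y) 0 1]mxE.
  set a := x 0 0; set b := x 0 1; set c := y 0 0; set d := y 0 1.
  have A0 : 0 <= a ^+ 2 + b ^+ 2 by rewrite addr_ge0 ?sqr_ge0.
  have B0 : 0 <= c ^+ 2 + d ^+ 2 by rewrite addr_ge0 ?sqr_ge0.
  have := sqr_sqrtr A0; have := sqr_sqrtr B0.
  have := sqrtr_ge0 (a ^+ 2 + b ^+ 2); have := sqrtr_ge0 (c ^+ 2 + d ^+ 2).
  set s := Num.sqrt (a ^+ 2 + b ^+ 2); set t := Num.sqrt (c ^+ 2 + d ^+ 2).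
  move=> t0 s0 tE sE.
  have cs : a * c + b * d <= s * t.
    apply: le_trans (ler_norm _) _; rewrite -[leRHS]ger0_norm ?mulr_ge0 //.
    rewrite -ler_sqr ?nnegrE ?normr_ge0 // !real_normK ?num_real // exprMn sE tE.
    have := sqr_ge0 (a * d - b * c); rewrite !expr2; lra.
  rewrite -[s + t]ger0_norm ?addr_ge0 // -sqrtr_sqr ler_wsqrtr //.
  have -> : (s + t) ^+ 2 = s ^+ 2 + t ^+ 2 + 2 * (s * t) by ring.
  by rewrite sE tE !expr2; lra.
- rewrite !mxE !exprMn -mulrDr sqrtrM ?sqr_ge0 // sqrtr_sqr //.
- move=> /eqP; rewrite sqrtr_eq0 => h.
  have h0 := sqr_ge0 (x 0 0); have h1 := sqr_ge0 (x 0 1).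
  by apply: row2P; rewrite mxE; apply/eqP; rewrite -sqrf_eq0 eq_le; apply/andP; split; lra.
Qed.

Lemma enorm_coord v i : `|v 0 i| <= enorm v.
Proof.
rewrite enorm2E -sqrtr_sqr ler_wsqrtr //.
by case: (I2P i) => ->; rewrite ?lerDl ?lerDr sqr_ge0.
Qed.

Lemma enorm_le_sum v : enorm v <= `|v 0 0| + `|v 0 1|.
Proof.
rewrite enorm2E -[leRHS]ger0_norm ?addr_ge0 // -sqrtr_sqr ler_wsqrtr //.
rewrite -[v 0 0 ^+ 2]real_normK ?num_real // -[v 0 1 ^+ 2]real_normK ?num_real //.
by rewrite sqrrD; have := mulr_ge0 (normr_ge0 (v 0 0)) (normr_ge0 (v 0 1)); lra.
Qed.

(** The simplex lemma. Twice the signed area of the triangle, multiplied by the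
    three denominators, is an integer, and the bounds on denominators and radius
    make it less than 1 in absolute value. *)
Lemma rational_cross_eq0 (c : 'rV[R]_2) (rho : R) (q1 q2 q3 : nat)
    (p1 p2 p3 : 'rV[int]_2) : 0 < rho ->
  let near (q : nat) (p : 'rV[int]_2) := [/\ (1 <= q)%N,
    q%:R ^+ 3 * rho ^+ 2 <= 1 / 64 & enorm (c - q%:R^-1 *: p%:V) <= 2 * rho] in
  near q1 p1 -> near q2 p2 -> near q3 p3 ->
  let u := q1%:R^-1 *: p1%:V : 'rV[R]_2 in
  let v := q2%:R^-1 *: p2%:V : 'rV[R]_2 in
  let w := q3%:R^-1 *: p3%:V : 'rV[R]_2 in
  (v 0 0 - u 0 0) * (w 0 1 - u 0 1) - (v 0 1 - u 0 1) * (w 0 0 - u 0 0) = 0.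
Proof.
move=> rho0 near [q1p q1r d1] [q2p q2r d2] [q3p q3r d3] u v w.
have close x y i : enorm (c - x) <= 2 * rho -> enorm (c - y) <= 2 * rho ->
    `|x 0 i - y 0 i| <= 4 * rho.
  move=> hx hy.
  have : `|(x - y) 0 i| <= enorm (c - y) + enorm (c - x).
    apply: le_trans (enorm_coord _ _) _.
    have -> : x - y = (c - y) - (c - x) by apply: row2P; rewrite !mxE; ring.
    exact: norm_funB enorm_is_norm _ _.
  by rewrite !mxE; lra.
set X := _ - _.
have hX : `|X| <= 32 * rho ^+ 2.
  have m (x y z t : R) : `|x| <= 4 * rho -> `|y| <= 4 * rho -> `|z| <= 4 * rho ->
      `|t| <= 4 * rho -> `|x * y - z * t| <= 32 * rho ^+ 2.
    move=> hx hy hz ht; apply: le_trans (ler_normB _ _) _; rewrite !normrM.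
    have := ler_pM (normr_ge0 _) (normr_ge0 _) hx hy.
    have := ler_pM (normr_ge0 _) (normr_ge0 _) hz ht.
    by rewrite expr2; lra.
  by apply: m; exact: close.
(* Y is the determinant of the rows (p_i, q_i). *)
pose Y : int := p2 0 0 * p3 0 1 * q1%:Z - p2 0 0 * p1 0 1 * q3%:Z
   - p1 0 0 * p3 0 1 * q2%:Z - p2 0 1 * p3 0 0 * q1%:Z + p2 0 1 * p1 0 0 * q3%:Z
   + p1 0 1 * p3 0 0 * q2%:Z.
have q1R : 0 < q1%:R :> R by rewrite ltr0n.
have q2R : 0 < q2%:R :> R by rewrite ltr0n.
have q3R : 0 < q3%:R :> R by rewrite ltr0n.
have XY : q1%:R * q2%:R * q3%:R * X = Y%:~R.
  rewrite /X /u /v /w !mxE /Y !(intrD, intrN, intrM, mulrz_nat).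
  by field; rewrite !gt_eqF.
have Q3 : q1%:R * q2%:R * q3%:R * rho ^+ 2 <= 1 / 64.
  have z0 : 0 <= q1%:R * q2%:R * q3%:R * rho ^+ 2 by apply: mulr_ge0; rewrite ?sqr_ge0 // -!natrM ler0n.
  have z1 : 0 <= 1 / 64 :> R by rewrite divr_ge0.
  rewrite -(ler_pXn2r (n := 3)) ?nnegrE //.
  have -> : (q1%:R * q2%:R * q3%:R * rho ^+ 2) ^+ 3 = (q1%:R ^+ 3 * rho ^+ 2)
     * (q2%:R ^+ 3 * rho ^+ 2) * (q3%:R ^+ 3 * rho ^+ 2) by ring.
  have -> : (1 / 64 : R) ^+ 3 = (1 / 64) * (1 / 64) * (1 / 64) by ring.
  have n0 (q : nat) : 0 <= q%:R ^+ 3 * rho ^+ 2 :> R.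
    by rewrite mulr_ge0 ?sqr_ge0 // exprn_ge0.
  apply: ler_pM => //; [exact: mulr_ge0|exact: ler_pM].
have Q0 : 0 < q1%:R * q2%:R * q3%:R :> R by rewrite !mulr_gt0.
have Ysmall : `|Y%:~R| < 1 :> R.
  rewrite -XY normrM gtr0_norm //.
  have := ler_wpM2l (ltW Q0) hX; lra.
have Y0 : Y = 0.
  apply/eqP; rewrite -normr_eq0 -[_ == _]negbK -normr_gt0 normr_id gtz0_ge1.
  by apply/negP; rewrite -(ler1z R) intr_norm leNgt Ysmall.
apply/eqP; move: XY; rewrite Y0 => /eqP; rewrite mulf_eq0 => /orP[|//].
by rewrite (gt_eqF Q0).
Qed.

(** The line through two distinct such points contains all of them, by the
    simplex lemma. Letting b be any pair makes the line a function of Bob's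
    last move alone, hence a strategy that is legal on every history. *)
Lemma rational_points_on_line (b : 'rV[R]_2 * R) : exists L : set 'rV[R]_2,
  is_hyperplane L /\ (0 < b.2 -> forall (q : nat) (p : 'rV[int]_2), (1 <= q)%N ->
    q%:R ^+ 3 * b.2 ^+ 2 <= 1 / 64 -> enorm (b.1 - q%:R^-1 *: p%:V) <= 2 * b.2 ->
    L (q%:R^-1 *: p%:V)).
Proof.
case: b => c rho /=.
pose near (q : nat) (p : 'rV[int]_2) := [/\ (1 <= q)%N,
  q%:R ^+ 3 * rho ^+ 2 <= 1 / 64 & enorm (c - q%:R^-1 *: p%:V) <= 2 * rho].
pose pt (q : nat) (p : 'rV[int]_2) : 'rV[R]_2 := q%:R^-1 *: p%:V.
have [[q1 [p1 [q2 [p2 [n1 n2 ne]]]]]|no] := pselect (exists q1 p1 q2 p2,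
    [/\ near q1 p1, near q2 p2 & pt q1 p1 <> pt q2 p2]).
  set u := pt q1 p1 in ne; set v := pt q2 p2 in ne.
  pose a : 'rV[R]_2 := \row_j if j == 0 then u 0 1 - v 0 1 else v 0 0 - u 0 0.
  have a0E : a 0 0 = u 0 1 - v 0 1 by rewrite mxE eqxx.
  have a1E : a 0 1 = v 0 0 - u 0 0 by rewrite mxE.
  exists [set x | \sum_(i < 2) a 0 i * x 0 i = a 0 0 * u 0 0 + a 0 1 * u 0 1]; split.
    exists a, (a 0 0 * u 0 0 + a 0 1 * u 0 1); split => //.
    apply/eqP => /rowP az; apply: ne.
    by apply: row2P; [have := az 1; rewrite a1E|have := az 0; rewrite a0E];
      rewrite [RHS]mxE => h; lra.
  move=> rho0 q p q1' q2' q3'; rewrite /= sum2 a0E a1E.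
  have := rational_cross_eq0 rho0 n1 n2 (And3 q1' q2' q3').
  rewrite -/(pt q1 p1) -/(pt q2 p2) -/u -/v -/(pt q p) => h.
  by apply/eqP; rewrite -subr_eq0; apply/eqP; rewrite -[RHS]h; ring.
have [x0 hx0] : exists x0 : 'rV[R]_2, forall q p, near q p -> pt q p = x0.
  have [[q [p npq]]|none] := pselect (exists q p, near q p).
    exists (pt q p) => q' p' n'; apply: contrapT => ne; apply: no.
    by exists q', p', q, p.
  by exists 0 => q p npq; exfalso; apply: none; exists q, p.
pose a : 'rV[R]_2 := \row_j (j == 0)%:R.
exists [set x | \sum_(i < 2) a 0 i * x 0 i = \sum_(i < 2) a 0 i * x0 0 i]; split.
  exists a, (\sum_(i < 2) a 0 i * x0 0 i); split=> //.
  by apply/eqP => /rowP/(_ 0); rewrite !mxE eqxx => /eqP; rewrite oner_eq0.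
by move=> rho0 q p h1 h2 h3; rewrite /= -/(pt q p) (hx0 _ _ (And3 h1 h2 h3)).
Qed.

Lemma cball_radius_mono (b b' : 'rV[R]_2 * R) : 0 < b'.2 ->
  cball b' `<=` cball b ->
  [/\ `|b.1 0 0 - b'.1 0 0 - b'.2| <= b.2, `|b.1 0 0 - b'.1 0 0 + b'.2| <= b.2 &
    b'.2 <= b.2].
Proof.
case: b b' => c r [c' r'] /= r'0 sub.
pose e : 'rV[R]_2 := \row_j (j == 0)%:R.
have ne (a : R) : enorm (a *: e) <= `|a|.
  apply: le_trans (enorm_le_sum _) _.
  by rewrite !mxE /= mulr1 mulr0 normr0 addr0.
have inb (a : R) : `|a| <= r' -> `|c 0 0 - c' 0 0 - a| <= r.
  move=> ar.
  have : cball (c', r') (c' + a *: e).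
    rewrite /cball /closed_ball_ /=.
    have -> : c' - (c' + a *: e) = (- a) *: e by apply: row2P; rewrite !mxE; ring.
    by apply: le_trans (ne _) _; rewrite normrN.
  move=> /sub; rewrite /cball /closed_ball_ /= => /(le_trans (enorm_coord _ 0)).
  by rewrite !mxE /= mulr1 opprD addrA.
have h1 : `|c 0 0 - c' 0 0 - r'| <= r by apply: inb; rewrite gtr0_norm.
have h2 : `|c 0 0 - c' 0 0 + r'| <= r.
  by rewrite -[r' in X in `|X|]opprK; apply: inb; rewrite normrN gtr0_norm.
by split=> //; move: h1 h2; rewrite !ler_norml => /andP[? ?] /andP[? ?]; lra.
Qed.

Definition vertical_line (c : 'rV[R]_2) : set 'rV[R]_2 :=
  [set x | \sum_(i < 2) (i == 0)%:R * x 0 i = c 0 0].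

Lemma vertical_lineE c x : vertical_line c x <-> x 0 0 = c 0 0.
Proof. by rewrite /vertical_line /= sum2 /= mul1r mul0r addr0. Qed.

Lemma vertical_line_hyperplane c : is_hyperplane (vertical_line c).
Proof.
exists (\row_j (j == 0)%:R), (c 0 0); split.
  by apply/eqP => /rowP/(_ 0); rewrite !mxE eqxx => /eqP; rewrite oner_eq0.
rewrite /vertical_line; apply/seteqP; split=> x /= <-; rewrite !sum2 !mxE //.
Qed.

(** A ball inside b that avoids a line through the centre of b lies in one of
    the two half balls. *)
Lemma cball_avoid_vertical (b b' : 'rV[R]_2 * R) : 0 < b'.2 ->
  cball b' `<=` cball b -> (forall y, cball b' y -> ~ vertical_line b.1 y) ->
  b'.2 <= b.2 / 2.
Proof.
move=> r'0 sub avoid; have [h1 h2 _] := cball_radius_mono r'0 sub.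
have far : b'.2 < `|b.1 0 0 - b'.1 0 0|.
  rewrite ltNge; apply/negP => le.
  pose y : 'rV[R]_2 := \row_j if j == 0 then b.1 0 0 else b'.1 0 1.
  have y0 : y 0 0 = b.1 0 0 by rewrite mxE eqxx.
  have y1 : y 0 1 = b'.1 0 1 by rewrite mxE.
  apply: (avoid y); last by apply/vertical_lineE.
  rewrite /cball /closed_ball_ /=; apply: le_trans (enorm_le_sum _) _.
  rewrite [(_ - y) 0 0]mxE [(_ - y) 0 1]mxE [(- y) 0 0]mxE [(- y) 0 1]mxE y0 y1.
  by rewrite subrr normr0 addr0 distrC.
move: h1 h2 far; rewrite !ler_norml lter_normr => /andP[a1 a2] /andP[a3 a4] /orP[] f; lra.
Qed.

End Euclidean.

(** * The hyperplane absolute game *)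
Section Game.
Context {R : realType}.
Implicit Types (B : nat -> 'rV[R]_2 * R) (beta : R).

Lemma nested_cballs_meet B : (forall i, 0 < (B i).2) ->
  (forall i, cball (B i.+1) `<=` cball (B i)) ->
  (forall e, 0 < e -> exists i, (B i).2 < e) ->
  exists x, forall i, cball (B i) x.
Proof.
move=> r0 nest small.
have sub i j : (i <= j)%N -> cball (B j) `<=` cball (B i).
  elim: j => [|j IH]; first by rewrite leqn0 => /eqP ->.
  rewrite leq_eqVlt => /orP[/eqP -> //|]; rewrite ltnS => /IH h y /nest.
  exact: h.
have mono i j : (i <= j)%N -> (B j).2 <= (B i).2.
  by move=> /sub h; have [_ _] := cball_radius_mono (r0 j) h.
have centre i j : (i <= j)%N -> enorm ((B i).1 - (B j).1) <= (B i).2.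
  move=> ij; apply: (sub i j ij).
  by rewrite /cball /closed_ball_ /= subrr (norm_fun0 enorm_is_norm) ltW.
pose lo (k : 'I_2) : set R := [set (B n).1 0 k - (B n).2 | n in [set: nat]].
have lo_le k m n : (B m).1 0 k - (B m).2 <= (B n).1 0 k + (B n).2.
  have := le_trans (enorm_coord _ k) (centre m _ (leq_maxl m n)).
  have := le_trans (enorm_coord _ k) (centre n _ (leq_maxr m n)).
  by rewrite !mxE !ler_norml => /andP[h1 h2] /andP[h3 h4]; lra.
pose x : 'rV[R]_2 := \row_k sup (lo k).
have x_hi k n : x 0 k <= (B n).1 0 k + (B n).2.
  rewrite mxE; apply: ge_sup; first by exists ((B 0%N).1 0 k - (B 0%N).2), 0%N.
  by move=> _ [m _ <-]; exact: lo_le.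
have x_lo k n : (B n).1 0 k - (B n).2 <= x 0 k.
  rewrite mxE; apply: ub_le_sup; last by exists n.
  by exists ((B n).1 0 k + (B n).2) => _ [m _ <-]; exact: lo_le.
have xB n : enorm ((B n).1 - x) <= 2 * (B n).2.
  have h k : `|((B n).1 - x) 0 k| <= (B n).2.
    rewrite [X in `|X|]mxE [X in _ + X]mxE ler_norml.
    by have := x_hi k n; have := x_lo k n; move=> *; apply/andP; split; lra.
  by apply: le_trans (enorm_le_sum _) _; have := h 0; have := h 1; lra.
exists x => i; rewrite /cball /closed_ball_ /= leNgt; apply/negP => lt.
have [|n hn] := small ((enorm ((B i).1 - x) - (B i).2) / 2).
  by rewrite divr_gt0 // subr_gt0.
pose m := maxn i n.
have hm := mono n m (leq_maxr i n).
have hc := centre i m (leq_maxl i n).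
have := is_norm_triangle enorm_is_norm ((B i).1 - (B m).1) ((B m).1 - x).
by rewrite subrKA; have := xB m; lra.
Qed.

(** Alice alternates between the line carrying the rational points of small
    denominator near the current ball and the vertical line through its centre.
    For a rational p/q, the first ball of even index for which q counts as small
    has radius comparable to q^(-3/2), unless it is the very first ball; whether
    p/q is far from that ball or on the removed line, the limit point stays at
    distance at least beta times the radius from p/q. *)
Lemma BA_enorm_winning : hyperplane_absolute_winning (BA (@enorm R 2)).
Proof.
move=> beta /andP[beta0 beta3].
have [L hL] := choice (@rational_points_on_line R).
pose sigma (h : seq (@bob_move R 2)) : @alice_move R 2 :=
  let b := last (0, 0) h in
  (if odd (size h) then L b else vertical_line b.1, beta * b.2).
have beta1 : beta < 1 by lra.
exists sigma => [h b b0|B [r00 play]].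
  rewrite /sigma last_rcons /=; split; last by rewrite lexx mulr_gt0.
  case: ifP => _; first by have [] := hL b.
  exact: vertical_line_hyperplane.
have sigmaE i : sigma (mkseq B i.+1) =
    (if odd i then vertical_line (B i).1 else L (B i), beta * (B i).2).
  by rewrite /sigma mkseqS last_rcons size_rcons size_mkseq /=; case: (odd i).
have rb i : beta * (B i).2 <= (B i.+1).2 by case: (play i).
have r0 i : 0 < (B i).2.
  by elim: i => [//|i IH]; apply: lt_le_trans (rb i); rewrite mulr_gt0.
have nest i : cball (B i.+1) `<=` cball (B i).
  by move=> y /(play i).1 [].
have avoid i y : cball (B i.+1) y -> forall z,
    (if odd i then vertical_line (B i).1 else L (B i)) z -> beta * (B i).2 <= enorm (y - z).
  move=> /(play i).1 [_]; rewrite sigmaE /= => no z Lz; rewrite leNgt; apply/negP => lt.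
  by apply: no; exists z.
have halve i : odd i -> (B i.+1).2 <= (B i).2 / 2.
  move=> oi; apply: cball_avoid_vertical => // y By vy.
  have := avoid i y By y; rewrite oi => /(_ vy).
  by rewrite subrr (norm_fun0 enorm_is_norm) leNgt mulr_gt0.
have mono i : (B i.+1).2 <= (B i).2.
  by have [_ _] := cball_radius_mono (r0 i.+1) (nest i).
have pow j : (B j.*2).2 * 2 ^+ j <= (B 0%N).2.
  elim: j => [|j IH]; first by rewrite expr0 mulr1.
  apply: le_trans IH; rewrite doubleS exprS mulrA ler_wpM2r ?exprn_ge0 //.
  have := halve j.*2.+1; rewrite /= odd_double => /(_ isT).
  by have := mono j.*2; lra.
have small e : 0 < e -> exists j, (B j.*2).2 < e.
  move=> e0; have [n n0 hn] := large_nat ((B 0%N).2 / e); exists n.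
  rewrite ltr_pdivrMr // in hn.
  rewrite -(ltr_pM2r (_ : 0 < 2 ^+ n)) ?exprn_gt0 //.
  apply: le_lt_trans (pow n) _; apply: lt_le_trans hn _.
  by rewrite mulrC ler_wpM2l ?(ltW e0) // -natrX ler_nat ltnW // ltn_expl.
have [|x hx] := nested_cballs_meet r0 nest.
  by move=> e /small[j hj]; exists j.*2.
exists x; split; last by move=> i _; exact: hx.
apply/(BA_uniformP enorm_is_norm).
pose c := Num.min (beta ^+ 2 * (B 0%N).2 ^+ 2) (beta ^+ 6 / 64).
exists c; first by rewrite lt_min mulr_gt0 ?divr_gt0 ?exprn_gt0.
move=> q p q1; have qR : 0 < q%:R :> R by rewrite ltr0n.
have qz : q%:R != 0 :> R by rewrite gt_eqF.
pose P j := q%:R ^+ 3 * (B j.*2).2 ^+ 2 <= 1 / 64.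
have exP : exists j, P j.
  have q3 : 1 <= q%:R ^+ 3 :> R by rewrite exprn_ege1 // ler1n.
  have [|j hj] := small (1 / (8 * q%:R ^+ 3)); first by rewrite divr_gt0 // mulr_gt0 // exprn_gt0.
  exists j; rewrite /P; move: hj; rewrite ltr_pdivlMr ?mulr_gt0 ?exprn_gt0 //.
  move: (ltW (r0 j.*2)) q3; set r := (B _).2; set a := q%:R ^+ 3; clear => r0 a1 h.
  have h8 : r * a <= 1 / 8 by lra.
  have ra0 : 0 <= r * a by rewrite mulr_ge0 //; lra.
  apply: le_trans (_ : (r * a) ^+ 2 <= _); last by rewrite expr2; nra.
  by rewrite exprMn mulrC ler_wpM2l ?sqr_ge0 // expr2 ler_peMl //; lra.
pose j := ex_minn exP; have [Pj minj] : P j /\ forall n, P n -> (j <= n)%N.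
  by rewrite /j; case: ex_minnP.
pose z : 'rV[R]_2 := q%:R^-1 *: p%:V.
have xz : beta * (B j.*2).2 <= enorm (x - z).
  have [near|far] := leP (enorm ((B j.*2).1 - z)) (2 * (B j.*2).2).
    apply: (avoid j.*2 x (hx _)); rewrite odd_double.
    by have [_ h] := hL (B j.*2); exact: h.
  have := norm_fun_distl enorm_is_norm ((B j.*2).1 - z) ((B j.*2).1 - x).
  have -> : (B j.*2).1 - z - ((B j.*2).1 - x) = x - z.
    by apply: row2P; rewrite !mxE; ring.
  have hxj : enorm ((B j.*2).1 - x) <= (B j.*2).2 by exact: hx.
  have : beta * (B j.*2).2 <= 1 * (B j.*2).2 by rewrite ler_pM2r // ltW.
  by move: far hxj; clear; lra.
have -> : q%:R *: x - p%:V = q%:R *: (x - z).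
  by rewrite scalerBr /z scalerA mulfV // scale1r.
rewrite (norm_fun_scale_pos enorm_is_norm) ?ler0n // exprMn mulrA -exprS.
have bnd : (beta * (B j.*2).2) ^+ 2 <= enorm (x - z) ^+ 2.
  by rewrite lerXn2r ?nnegrE ?(norm_fun_ge0 enorm_is_norm) // mulr_ge0 ?ltW.
apply: le_trans (_ : q%:R ^+ 3 * (beta * (B j.*2).2) ^+ 2 <= _); last first.
  by rewrite ler_wpM2l // exprn_ge0 // ltW.
case: j {Pj xz bnd} minj => [|i] minj.
  apply: le_trans (_ : beta ^+ 2 * (B 0%N).2 ^+ 2 <= _).
    by rewrite /c ge_min lexx.
  rewrite exprMn; apply: ler_peMl; first by apply: mulr_ge0; exact: sqr_ge0.
  by rewrite exprn_ege1 // ler1n.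
have nPi : ~~ P i by apply/negP => /minj; rewrite ltnn.
rewrite /P -ltNge in nPi.
apply: le_trans (_ : beta ^+ 6 / 64 <= _); first by rewrite /c ge_min lexx orbT.
have r2 : beta ^+ 2 * (B i.*2).2 <= (B i.+1.*2).2.
  rewrite doubleS; apply: le_trans (rb _).
  by rewrite expr2 -mulrA ler_pM2l.
have r3 : (beta ^+ 2 * (B i.*2).2) ^+ 2 <= (B i.+1.*2).2 ^+ 2.
  by rewrite lerXn2r ?nnegrE ?mulr_ge0 ?sqr_ge0 // ltW.
have b2 : 0 <= beta ^+ 2 by exact: sqr_ge0.
have q3 : 0 <= q%:R ^+ 3 :> R by rewrite exprn_ge0 // ltW.
apply: le_trans (_ : q%:R ^+ 3 * (beta ^+ 2 * (beta ^+ 2 * (B i.*2).2) ^+ 2) <= _).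
  have -> : q%:R ^+ 3 * (beta ^+ 2 * (beta ^+ 2 * (B i.*2).2) ^+ 2)
    = beta ^+ 6 * (q%:R ^+ 3 * (B i.*2).2 ^+ 2) by ring.
  have -> : beta ^+ 6 / 64 = beta ^+ 6 * (1 / 64) by rewrite mul1r.
  by rewrite ler_wpM2l ?exprn_ge0 // ltW.
by rewrite [(beta * _) ^+ 2]exprMn ler_wpM2l // ler_wpM2l.
Qed.

Lemma hyperplane_absolute_winningS d (S S' : set 'rV[R]_d) : S `<=` S' ->
  hyperplane_absolute_winning S -> hyperplane_absolute_winning S'.
Proof.
move=> SS' win beta hbeta; have [sigma legal hs] := win beta hbeta.
exists sigma => // B /hs[x [Sx xB]]; exists x; split=> //; exact: SS'.
Qed.

End Game.

Theorem theorem1p1 (R : realType) (nu : 'rV[R]_2 -> R) (hnu : is_norm nu) :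
  (forall mu : 'rV[R]_2 -> R, is_norm mu -> BA mu `<=` DI nu) /\
  hyperplane_absolute_winning (DI nu).
Proof.
have sub (mu : 'rV[R]_2 -> R) : is_norm mu -> BA mu `<=` DI nu.
  by move=> hmu x /(BA_norm_independent hmu hnu); exact: BA_sub_DI.
split=> //.
exact: hyperplane_absolute_winningS (sub _ enorm_is_norm) BA_enorm_winning.
Qed.
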